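(* Let $\mathcal{L},\mathcal{R}\subset\mathbb{Z}^d\times\mathbb{Z}^d$ be independent random relations such that the stochastic dimensions $\dim_S(\mathcal{L})$ and $\dim_S(\mathcal{R})$ exist. Then the composition $\mathcal{L}\mathcal{R}$ has a stochastic dimension, and $$\dim_S(\mathcal{L}\mathcal{R})=\min\bigl\{\dim_S(\mathcal{L})+\dim_S(\mathcal{R}),\,d\bigr\}.$$
   Context: For $x,y\in\mathbb{Z}^d$ write $\langle xy\rangle:=1+\|x-y\|_1$. For a nonempty finite set $W\subset\mathbb{Z}^d$, the spread of $W$ is $\langle W\rangle:=\min_\tau\prod_{\{x,y\}\in\tau}\langle xy\rangle$, where $\tau$ ranges over all trees on the vertex set $W$ (not necessarily subgraphs of $\mathbb{Z}^d$) and the product is over the undirected edges of $\tau$ (an empty product is $1$); $\langle xzyw\rangle$ denotes the spread of $\{x,z,y,w\}$. A random relation is a random subset $\mathcal{R}\subset\mathbb{Z}^d\times\mathbb{Z}^d$; write $x\mathcal{R}y$ for $(x,y)\in\mathcal{R}$. For $\alpha\in[0,d)$, $\mathcal{R}$ has stochastic dimension $d-\alpha$, written $\dim_S(\mathcal{R})=d-\alpha$, if there is a constant $C=C(\mathcal{R})<\infty$ such that for all $x,y,z,w\in\mathbb{Z}^d$, $$C\,\mathbf{P}[x\mathcal{R}z]\ge\langle xz\rangle^{-\alpha}$$ and $$\mathbf{P}[x\mathcal{R}z,\ y\mathcal{R}w]\le C\langle xz\rangle^{-\alpha}\langle yw\rangle^{-\alpha}+C\langle xzyw\rangle^{-\alpha}.$$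 The composition $\mathcal{L}\mathcal{R}$ is the set of all $(x,z)\in\mathbb{Z}^d\times\mathbb{Z}^d$ such that there is some $y\in\mathbb{Z}^d$ with $x\mathcal{L}y$ and $y\mathcal{R}z$. *)

(* Defs.v *)
From HB Require Import structures.
From mathcomp Require Import all_boot all_order all_algebra finmap.
From mathcomp Require Import all_classical all_reals all_analysis.

Set Implicit Arguments.
Unset Strict Implicit.
Unset Printing Implicit Defensive.

Import Order.TTheory GRing.Theory Num.Theory.

Local Open Scope classical_set_scope.
Local Open Scope ring_scope.

Notation Zd d := ('rV[int]_d).

Definition bracket (d : nat) (x y : Zd d) : nat :=
  (1 + \sum_(i < d) `|x ord0 i - y ord0 i|)%N.

(* A graph on the vertex set [T] is given by its set of undirected edges. *)
Definition edge_rel (T : finType) (E : {set {set T}}) : rel T :=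
  [rel x y | [set x; y]%SET \in E].

Definition is_tree (T : finType) (E : {set {set T}}) : Prop :=
  [/\ forall e, e \in E -> #|e| = 2,
      forall x y, connect (edge_rel E) x y
    & forall c : seq T, ucycle (edge_rel E) c -> (size c <= 2)%N].

(* The default value 1 is never used in a tree, whose edges are pairs; the
   order in which [enum e] lists the endpoints is irrelevant since [bracket] is
   symmetric. *)
Definition edge_weight (d : nat) (W : {fset Zd d}) (e : {set W}) : nat :=
  if enum e is [:: x; y] then bracket (val x) (val y) else 1%N.

Definition tree_weight (d : nat) (W : {fset Zd d}) (E : {set {set W}}) : nat :=
  (\prod_(e in E) edge_weight e)%N.

(* The seed [set0] of the minimization is irrelevant when [W] is nonempty, as
   there is then a tree on [W]: see [spreadP]. *)
Definition spread (d : nat) (W : {fset Zd d}) : nat :=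
  tree_weight
    [arg min_(E < (finset.set0 : {set {set W}}) | `[< is_tree E >])
       tree_weight E].

Lemma star_is_tree (T : finType) (x0 : T) :
  is_tree [set [set x0; y]%SET | y in [set~ x0]%SET]%SET.
Proof.
set E := (X in is_tree X).
have adj0 y : y != x0 -> edge_rel E x0 y.
  by move=> yx0; apply/imsetP; exists y; rewrite ?inE.
have adjP x y : edge_rel E x y -> x = x0 \/ y = x0.
  move=> /imsetP[z _ /setP/(_ x0)]; rewrite !inE eqxx /=.
  by case/orP => /eqP ->; [left|right].
split.
- by move=> e /imsetP[y]; rewrite !inE => yx0 ->; rewrite cards2 eq_sym yx0.
- have c0 y : connect (edge_rel E) x0 y /\ connect (edge_rel E) y x0.
    have [->//|yx0] := eqVneq y x0.
    split; apply: connect1; first exact: adj0.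
    by rewrite /edge_rel /= finset.setUC; exact: adj0.
  by move=> x y; apply: (connect_trans (c0 x).2 (c0 y).1).
- case=> [|a [|b [|c s]]] // /andP[].
  rewrite /= rcons_path !inE !negb_or => /and4P[/adjP ab /adjP bc _ /adjP la].
  move=> /and3P[/and3P[nab nac _] /andP[nbc bs] _].
  have nl : last c s != b.
    apply: contraNneq nbc => lb; have := mem_last c s.
    by rewrite lb inE (negPf bs) orbF.
  case: (eqVneq b x0) => [b0|b0].
    subst b; case: la => h; last by rewrite h eqxx in nab.
    by rewrite h eqxx in nl.
  case: ab => h; last by rewrite h eqxx in b0.
  case: bc => h'; first by rewrite h' eqxx in b0.
  by rewrite h h' eqxx in nac.
Qed.

Lemma spreadP (d : nat) (W : {fset Zd d}) : W != fset0 ->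
  (exists2 E : {set {set W}}, is_tree E & spread W = tree_weight E) /\
  (forall E : {set {set W}}, is_tree E -> (spread W <= tree_weight E)%N).
Proof.
case/fset0Pn => x xW; have /asboolP treeS := star_is_tree [` xW]%fset.
have -> : spread W = tree_weight
    [arg min_(E < [set [set [` xW]%fset; y]%SET | y in [set~ [` xW]%fset]%SET]%SET
      | `[< is_tree E >]) tree_weight E].
  rewrite /spread /arg_min /extremum; case: pickP => //= none.
  have [E tE minE] :=
    arg_minnP (P := fun E => `[< is_tree E >]) (fun E => tree_weight E) treeS.
  have := none E; rewrite /= tE /=.
  by move/negbT/forallPn => [F]; rewrite negb_imply => /andP[tF]; rewrite minE.
case: arg_minnP => // E /asboolP tE minE; split; first by exists E.
by move=> F /asboolP; exact: minE.
Qed.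

Definition rel_event (T : Type) (d : nat) (Rel : T -> set (Zd d * Zd d))
    (x z : Zd d) : set T :=
  [set w | Rel w (x, z)].

Definition random_relation (disp : measure_display) (T : measurableType disp)
    (d : nat) (Rel : T -> set (Zd d * Zd d)) : Prop :=
  forall x z, measurable (rel_event Rel x z).

Definition relation_sigma (T : Type) (d : nat)
    (Rel : T -> set (Zd d * Zd d)) : set (set T) :=
  <<s [set A | exists x z, A = rel_event Rel x z] >>.

Definition independent_relations (disp : measure_display)
    (T : measurableType disp) (R : realType) (P : probability T R) (d : nat)
    (L Rel : T -> set (Zd d * Zd d)) : Prop :=
  forall A B, relation_sigma L A -> relation_sigma Rel B ->
    P (A `&` B) = (P A * P B)%E.

(* [stochastic_dimension P Rel s] means dim_S(Rel) = s. *)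
Definition stochastic_dimension (disp : measure_display)
    (T : measurableType disp) (R : realType) (P : probability T R) (d : nat)
    (Rel : T -> set (Zd d * Zd d)) (s : R) : Prop :=
  exists alpha : R, [/\ 0 <= alpha < d%:R, s = d%:R - alpha &
    exists C : R, forall x y z w : Zd d,
      (((bracket x z)%:R `^ (- alpha))%:E <= C%:E * P (rel_event Rel x z))%E /\
      (P (rel_event Rel x z `&` rel_event Rel y w) <=
       (C * (bracket x z)%:R `^ (- alpha) * (bracket y w)%:R `^ (- alpha) +
        C * (spread [fset x; z; y; w]%fset)%:R `^ (- alpha))%:E)%E].

Definition composition (T : Type) (d : nat)
    (L Rel : T -> set (Zd d * Zd d)) : T -> set (Zd d * Zd d) :=
  fun w => [set xz | exists y, L w (xz.1, y) /\ Rel w (y, xz.2)].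

(* Main.v *)
From HB Require Import structures.
Require Import Defs.
From mathcomp Require Import all_boot all_order all_algebra finmap.
From mathcomp Require Import all_classical all_reals all_analysis.
From mathcomp Require Import measurable_realfun zify ring lra.

Set Implicit Arguments.
Unset Strict Implicit.
Unset Printing Implicit Defensive.

Import Order.TTheory GRing.Theory Num.Theory.

Local Open Scope classical_set_scope.
Local Open Scope ring_scope.

(** Write [d - a] and [d - b] for the dimensions of the two relations and
    [g = a + b - d].  The composition has dimension [d - max(g, 0)].  Let
    [decay a x y] be the power [- a] of [bracket x y], and [spread_decay a] that of
    the spread of four points.

    Measurability holds because a composition is a countable union over the
    intermediate point.

    Upper bound.  It is trivial for [g <= 0], where the exponent is [0].  For
    [g > 0], the probability of [x L R z] and [y L R w] is at most the sum over the
    intermediate points [u], [v] of the product of the two joint laws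
    ([composition_upper]), so that everything rests on a deterministic estimate
    ([pair_sum_le]).  This has two ingredients.  The first is the convolution
    [sum_y decay a u y * decay b y v <= C * decay g u v] ([convolution_le]), which
    follows from summing over dyadic shells.  The second is that the spread, for
    any enumeration of the points, is up to a constant the weight of the greedy
    tree joining each point to the nearest earlier one ([spread_chain],
    [spread4_le], [spread4_ge]).  Enumerating the summation variables last turns
    the sums of spreads into convolutions, and what remains are weights of trees
    on [x], [z], [y], [w].  The comparison of greedy trees for different
    enumerations comes from exchanging two consecutive points ([chain_swap]); the
    comparison with the spread comes from exploring an optimal tree from one of
    its vertices ([chain_explore]).

    Lower bound.  The second moment method ([chung_erdos]) is applied to the number
    of intermediate points in a finite box.  By independence and the joint bounds,
    the probability that this number is positive is at least a constant times
    [M / k], where [M] is the sum of [decay a x y * decay b y z] over the box and [k]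
    bounds similar sums in which [x] or [z] may be replaced by a point of the box
    ([composition_lower]).  For [g > 0] the box of radius [bracket x z] has [M] of
    order [decay g x z] and [k] bounded ([second_moment_box_gt]).  For [g <= 0] the sum
    of [decay (a + b) 0 y] over all [y] diverges, and it grows at most by a constant
    factor when the box is tripled; so in a large enough box [M] and [k] are of the
    same order ([second_moment_box_le]). *)

(** * Greedy trees *)

Section Chain.
Local Open Scope nat_scope.
Variables (T : eqType) (b : T -> T -> nat).

(** The earlier points are kept as a head [p] and a list [s], so that the minimum
    ranges over a nonempty set. *)
Definition near (p : T) (s : seq T) (v : T) : nat :=
  \big[minn/b p v]_(u <- s) b u v.

(** The weight of the tree that joins each point of [r], in this order, to the
    nearest of the points listed before it. *)
Fixpoint chain (p : T) (s r : seq T) : nat :=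
  if r is v :: r' then near p s v * chain p (v :: s) r' else 1.

Lemma near_le p s v u : u \in p :: s -> near p s v <= b u v.
Proof.
rewrite /near; elim: s => [|a s IH]; first by rewrite inE big_nil => /eqP ->.
rewrite big_cons !inE => /or3P[/eqP up|/eqP ->|us]; rewrite geq_min ?leqnn //.
- by rewrite IH ?orbT // inE up eqxx.
- by rewrite IH ?orbT // inE us orbT.
Qed.

Lemma nearP p s v : exists2 u, u \in p :: s & near p s v = b u v.
Proof.
rewrite /near; elim: s => [|a s [u us uE]].
  by exists p; rewrite ?inE ?eqxx // big_nil.
rewrite big_cons; case: (leqP (b a v) (\big[minn/b p v]_(u <- s) b u v)) => h.
  by exists a; rewrite ?inE ?eqxx ?orbT.
exists u => //.
by move: us; rewrite !inE => /orP[->//|->]; rewrite !orbT.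
Qed.

Lemma chain_eq_near p s s' r : near p s =1 near p s' ->
  chain p s r = chain p s' r.
Proof.
elim: r s s' => [//|v r IH] s s' e /=; rewrite e; congr (_ * _).
by apply: IH => w; rewrite /near !big_cons; congr minn; exact: e.
Qed.

Hypotheses (bC : forall x y, b x y = b y x)
  (bD : forall x y z, b x y <= b x z + b z y).

(** Exchanging two consecutive points: with [A], [B] the distances of [u], [v]
    to the earlier points and [c] that of [u] to [v], the claim is
    [A * min(c, B) <= 2 * (B * min(c, A))].  If [A <= c] this is clear;
    otherwise it follows from [A <= B + c], which is at most twice the larger of
    [B] and [c]. *)
Lemma chain_swap p s u v r :
  chain p s (u :: v :: r) <= 2 * chain p s (v :: u :: r).
Proof.
have tail : chain p (v :: u :: s) r = chain p (u :: v :: s) r.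
  by apply: chain_eq_near => w; rewrite /near !big_cons minnCA.
rewrite /= tail !mulnA leq_mul2r; apply/orP; right.
rewrite /near !big_cons -!/(near p s _) (bC v u).
have tri : near p s u <= near p s v + b u v.
  have [w ws ->] := nearP p s v.
  apply: leq_trans (near_le u ws) _.
  by rewrite (bC u v); apply: bD.
move: (near p s u) (near p s v) (b u v) tri => A B c tri.
rewrite /minn; case: ifP => h1; case: ifP => h2; nia.
Qed.

Lemma chain_to_front p s r1 v r2 :
  chain p s (r1 ++ v :: r2) <= 2 ^ size r1 * chain p s (v :: r1 ++ r2).
Proof.
elim: r1 s => [|u r1 IH] s; first by rewrite expn0 mul1n.
apply: (@leq_trans (2 ^ size r1 * chain p s (u :: v :: r1 ++ r2))).
  rewrite cat_cons /= mulnCA leq_mul2l; apply/orP; right; exact: IH.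
by rewrite expnSr -mulnA leq_mul2l chain_swap orbT.
Qed.

End Chain.

(** * Connected graphs and spanning trees *)

Section Graph.
Local Open Scope nat_scope.
Local Open Scope set_scope.
Variables (T : finType).

Lemma edge_relC (E : {set {set T}}) x y : edge_rel E x y = edge_rel E y x.
Proof. by rewrite /edge_rel /= finset.setUC. Qed.

Lemma connect_edgeC (E : {set {set T}}) x y :
  connect (edge_rel E) x y = connect (edge_rel E) y x.
Proof. by apply: sym_connect_sym => a c; exact: edge_relC. Qed.

Lemma edge_across (E : {set {set T}}) (S : {set T}) (p q : T) :
  connect (edge_rel E) p q -> p \in S -> q \notin S ->
  exists u v, [/\ u \in S, v \notin S & [set u; v] \in E].
Proof.
case/connectP => l; elim: l p => [|c l IH] p /=.
  by move=> _ -> ->.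
case/andP=> pc cl e pS qS; have [cS|cS] := boolP (c \in S).
  exact: IH cl e cS qS.
by exists p, c.
Qed.

(** Dropping an edge of a cycle keeps a graph connected, so a connected graph
    with as few edges as possible is a tree. *)
Lemma connected_subtree (E : {set {set T}}) :
  (forall e, e \in E -> #|e| = 2) ->
  (forall x y, connect (edge_rel E) x y) ->
  exists2 E' : {set {set T}}, E' \subset E & is_tree E'.
Proof.
have [n] := ubnP #|E|; elim: n E => // n IH E /ltnSE cE E2 Ec.
have [tE|nE] := pselect (forall c : seq T, ucycle (edge_rel E) c -> size c <= 2).
  by exists E.
have [c uc c3] : exists2 c : seq T, ucycle (edge_rel E) c & 2 < size c.
  apply: contrapT => H; apply: nE => c uc; rewrite leqNgt; apply/negP => h.
  by apply: H; exists c.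
case: c uc c3 => [|x [|y [|z s]]] // /andP[cyc un] _.
move: cyc un => /= /and3P[xy yz zs] /and3P[xn yn _].
set e := [set x; y]; have eE : e \in E by exact: xy.
pose E' := E :\ e.
have keep a q : edge_rel E a q -> [set a; q] != e -> edge_rel E' a q.
  by move=> aq ne; rewrite /edge_rel /= in_setD1 ne.
have ney q l : q != x -> q != y -> [set q; l] != e.
  move=> qx qy; apply/eqP => /setP/(_ q); rewrite !inE eqxx /=.
  by rewrite (negPf qx) (negPf qy).
have zx : z != x by move: xn; rewrite !inE !negb_or (eq_sym x z) => /and3P[].
have zy : z != y by move: yn; rewrite !inE !negb_or (eq_sym y z) => /andP[].
have yz' : edge_rel E' y z.
  by rewrite edge_relC; apply: keep; [rewrite edge_relC|exact: ney].
have far q : q \in z :: s -> (q != x) && (q != y).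
  move=> qs; apply/andP; split.
    by apply: contraNneq xn => <-; rewrite inE qs orbT.
  by apply: contraNneq yn => <-.
(* The rest of the cycle leads from [z] back to [x] through edges other than [e]. *)
have zx' : connect (edge_rel E') z x.
  have : {subset z :: s <= [pred q | (q != x) && (q != y)]} by exact: far.
  elim: (s) (z) zs => [|w l IHl] q /=.
    rewrite andbT => qx sub; apply: connect1; apply: keep => //.
    by have /andP[] := sub q (mem_head _ _); exact: ney.
  case/andP=> qw wl sub; apply: (@connect_trans _ _ w).
    apply: connect1; apply: keep => //.
    by have /andP[] := sub q (mem_head _ _); exact: ney.
  by apply: IHl wl _ => t tl; apply: sub; rewrite inE tl orbT.
have xy' : connect (edge_rel E') x y.
  rewrite connect_edgeC; apply: connect_trans zx'; exact: connect1.
have [|||E'' sub tr] := IH E'.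
- by apply: leq_trans cE; rewrite /E' [X in _ < X](cardsD1 e) eE.
- by move=> f; rewrite in_setD1 => /andP[_ /E2].
- move=> a q; apply: connect_sub (Ec a q) => {}a {}q aq.
  have [eaq|] := eqVneq [set a; q] e; last by move=> ?; apply/connect1/keep.
  have : a \in e by rewrite -eaq !inE eqxx.
  have : q \in e by rewrite -eaq !inE eqxx orbT.
  rewrite !inE => /orP[]/eqP-> /orP[]/eqP-> //.
  by rewrite connect_edgeC.
by exists E'' => //; apply: fintype.subset_trans sub (subsetDl _ _).
Qed.

Variables (b : T -> T -> nat) (w : {set T} -> nat).
Hypotheses (bxx : forall x, b x x = 1) (w1 : forall e, 0 < w e)
  (wE : forall x y, x != y -> w [set x; y] = b x y).

(** Joining each point of [r] to its nearest predecessor extends a connected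
    graph on the points listed so far. *)
Lemma chain_extend p s r (E : {set {set T}}) :
  (forall e, e \in E -> #|e| = 2) ->
  (forall x, x \in p :: s -> connect (edge_rel E) p x) ->
  exists E' : {set {set T}}, [/\ forall e, e \in E' -> #|e| = 2,
    forall x, x \in p :: s ++ r -> connect (edge_rel E') p x &
    \prod_(e in E') w e <= \prod_(e in E) w e * chain b p s r].
Proof.
elim: r s E => [|v r IH] s E E2 Ec; first by exists E; rewrite cats0 muln1.
have [u us uE] := nearP b p s v.
pose E1 := if u == v then E else [set u; v] |: E.
have [||E' [E'2 E'c E'w]] := IH (v :: s) E1.
- move=> e; rewrite /E1; case: ifPn => [_ /E2 //|uv].
  by rewrite in_setU1 => /orP[/eqP->|/E2 //]; rewrite cards2 uv.
- have sub : subrel (connect (edge_rel E)) (connect (edge_rel E1)).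
    apply: connect_sub => x y xy; apply: connect1; rewrite /E1.
    by case: ifP => // _; rewrite /edge_rel /= in_setU1; apply/orP; right.
  move=> x; rewrite !inE orbCA => /orP[/eqP ->|xs]; last first.
    by apply: sub; apply: Ec; rewrite inE.
  apply: connect_trans (sub _ _ (Ec u us)) _; rewrite /E1.
  case: ifPn => [/eqP -> //|_].
  by apply: connect1; rewrite /edge_rel /= in_setU1 eqxx.
exists E'; split => //.
  move=> x xs; apply: E'c; move: xs.
  by rewrite !(inE, mem_cat) => /or4P[] ->; rewrite ?orbT.
apply: (leq_trans E'w); rewrite /= uE mulnA leq_mul2r; apply/orP; right.
rewrite /E1; case: ifPn => [/eqP ->|uv]; first by rewrite bxx muln1.
have [uvE|uvE] := boolP ([set u; v] \in E).
  rewrite (_ : _ |: _ = E) ?leq_pmulr //.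
    by rewrite -(wE uv).
  by apply/finset.setUidPr; rewrite finset.sub1set.
by rewrite big_setU1 //= wE // mulnC.
Qed.

Hypotheses (bC : forall x y, b x y = b y x)
  (bD : forall x y z, b x y <= b x z + b z y).

(** A connected graph is explored from [p], each new point being reached from
    the explored set through an edge that was not inside this set before; the
    new point is pulled to the front of the list, at the cost of a constant. *)
Lemma chain_explore p s r (E : {set {set T}}) :
  (forall x y, connect (edge_rel E) x y) ->
  (forall x, x \in p :: s ++ r) ->
  chain b p s r <= 2 ^ (size r ^ 2) *
    \prod_(e in E | ~~ (e \subset [set x | x \in p :: s])) w e.
Proof.
move=> Ec; have [n] := ubnP (size r); elim: n s r => // n IH s r /ltnSE rn all.
have [->|r0] := eqVneq r [::].
  by rewrite /= expn0 mul1n prodn_gt0.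
set S := [set x | x \in p :: s].
(* [F S] is the weight of the edges that do not lie inside [S]. *)
pose F (S : {set T}) := \prod_(e in E | ~~ (e \subset S)) w e.
have [v vr step] : exists2 v, v \in r & near b p s v * F (v |: S) <= F S.
  have [/hasP[v vr vS]|/hasPn nr] := boolP (has (fun x => x \in S) r).
    exists v => //; rewrite (_ : v |: S = S); last first.
      by apply/finset.setUidPr; rewrite finset.sub1set.
    rewrite -[leqRHS]mul1n leq_mul2r; apply/orP; right.
    by move: vS; rewrite inE => /(near_le b v); rewrite bxx.
  have pS : p \in S by rewrite inE mem_head.
  have [q qr] : exists q, q \in r.
    by case: (r) r0 => // q l _; exists q; rewrite mem_head.
  have [u [v [uS vS uvE]]] := edge_across (Ec p q) pS (nr q qr).
  have uv : u != v by apply: contraNneq vS => <-.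
  exists v.
    have := all v; move: vS; rewrite !inE mem_cat.
    by case: (v == p) (v \in s) => [] [].
  rewrite /F [leqRHS](bigD1 [set u; v]) /=; last first.
    rewrite uvE; apply: contraNN vS => /fintype.subsetP; apply.
    by rewrite !inE eqxx orbT.
  apply: leq_mul; first by rewrite wE //; move: uS; rewrite inE => /near_le.
  rewrite [leqLHS]big_mkcond [leqRHS]big_mkcond /=; apply: leq_prod => e _.
  case: (boolP (e \in E)) => //= eE.
  case: (boolP (e \subset v |: S)) => /= h1; first by case: ifP.
  rewrite (_ : ~~ (e \subset S)); last first.
    by apply: contraNN h1 => /fintype.subset_trans; apply; exact: finset.subsetUr.
  rewrite (_ : e != [set u; v]) //.
  apply: contraNneq h1 => ->; apply/fintype.subsetP => x.
  by rewrite in_set2 in_setU1 => /orP[]/eqP->; rewrite ?uS ?orbT ?eqxx.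
have [r1 [r2 rE]] : exists r1 r2, r = r1 ++ v :: r2.
  by case/splitPr: vr => r1 r2; exists r1, r2.
have sz : size r = (size (r1 ++ r2)).+1 by rewrite rE !size_cat /= addnS.
rewrite -/(F S) rE; apply: (leq_trans (chain_to_front bC bD _ _ _ _ _)).
have := IH (v :: s) (r1 ++ r2); rewrite -sz => /(_ rn).
have -> : [set x | x \in p :: v :: s] = v |: S.
  by apply/setP => x; rewrite !inE orbCA.
rewrite -/(F _) => IHr.
have {}IHr : chain b p (v :: s) (r1 ++ r2) <=
    2 ^ (size (r1 ++ r2) ^ 2) * F (v |: S).
  apply: IHr => x; have := all x; rewrite rE !(inE, mem_cat).
  by case: (x == v); rewrite ?orbT //=.
apply: (@leq_trans (2 ^ size r1 * (2 ^ (size (r1 ++ r2) ^ 2) * F S))).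
  rewrite leq_mul2l expn_eq0 /=.
  apply: leq_trans (leq_mul (leqnn _) IHr) _.
  by rewrite mulnCA leq_mul2l step orbT.
rewrite mulnA -expnD leq_mul2r; apply/orP; right.
(* With [n + 1] points left, moving one costs at most [n], and
   [n + n ^ 2 <= (n + 1) ^ 2]. *)
rewrite leq_exp2l // -rE sz size_cat; nia.
Qed.

End Graph.

(** * The spread of four lattice points *)

Section Bracket.
Local Open Scope nat_scope.
Variable d : nat.
Implicit Types x y z p q r s u v : Zd d.

Lemma bracketC x y : bracket x y = bracket y x.
Proof. by rewrite /bracket; congr addn; apply: eq_bigr => i _; exact: distnC. Qed.

Lemma bracketxx x : bracket x x = 1.
Proof. by rewrite /bracket big1 // => i _; rewrite subrr. Qed.

Lemma bracket_triangle x y z : bracket x y <= bracket x z + bracket z y.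
Proof.
rewrite /bracket; set A := \sum_(i < d) _; set B := \sum_(i < d) _.
set D := \sum_(i < d) _; suff : A <= B + D by lia.
by rewrite /A /B /D -big_split /=; apply: leq_sum => i _; exact: leqD_dist.
Qed.

Lemma edge_weight_pair (W : {fset Zd d}) (x y : W) : x != y ->
  edge_weight [set x; y]%SET = bracket (val x) (val y).
Proof.
move=> xy; rewrite /edge_weight.
have /perm_size := perm_refl (enum [set x; y]%SET); rewrite -[in RHS]cardE cards2 xy.
have := enum_uniq [set x; y]%SET.
have : forall z : W, z \in enum [set x; y]%SET -> z \in [set x; y]%SET.
  by move=> z; rewrite mem_enum.
case: (enum _) => [|a [|c [|]]] //= mem; rewrite inE andbT => ac _.
have := mem a (mem_head _ _); have := mem c; rewrite !inE eqxx orbT => /(_ isT).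
case/orP=> /eqP cE /orP[] /eqP aE; move: ac; rewrite aE cE ?eqxx //.
by rewrite bracketC.
Qed.

Lemma edge_weight_gt0 (W : {fset Zd d}) (e : {set W}) : 0 < edge_weight e.
Proof. by rewrite /edge_weight; case: (enum e) => [|a [|c [|]]]. Qed.

(** A greedy tree contains a spanning tree, and exploring an optimal tree shows
    that no enumeration of the points makes the greedy weight much larger than
    the spread. *)
Lemma spread_chain (W : {fset Zd d}) (p : W) (r : seq W) :
  (forall x : W, x \in p :: r) ->
  spread W <= chain (fun x y : W => bracket (val x) (val y)) p [::] r /\
  chain (fun x y : W => bracket (val x) (val y)) p [::] r
    <= 2 ^ (size r ^ 2) * spread W.
Proof.
move=> all; set b := (X in chain X).
have bxx (x : W) : b x x = 1 by exact: bracketxx.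
have wE (x y : W) : x != y -> edge_weight [set x; y]%SET = b x y.
  exact: edge_weight_pair.
have W0 : W != fset0 by apply/fset0Pn; exists (val p); exact: valP.
have [[E [E2 Ec Ea] ->] spread_min] := spreadP W0; split; last first.
  have bC (x y : W) : b x y = b y x by exact: bracketC.
  have bD (x y z : W) : b x y <= b x z + b z y by exact: bracket_triangle.
  have := chain_explore (s := [::]) (r := r) bxx (@edge_weight_gt0 W) wE bC bD Ec all.
  move=> /leq_trans; apply.
  rewrite leq_mul2l expn_eq0 /=; apply: (@leq_trans (\prod_(e in E) edge_weight e)) => //.
  rewrite [leqLHS]big_mkcond [leqRHS]big_mkcond; apply: leq_prod => e _.
  by case: (e \in E) => //=; case: ifP => // _; exact: edge_weight_gt0.
have [||E' [E'2 E'c E'w]] :=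
  chain_extend (p := p) (s := [::]) (E := finset.set0) bxx (@edge_weight_gt0 W) wE r _ _.
- by move=> e; rewrite inE.
- by move=> x; rewrite inE => /eqP->.
have E'c' (x y : W) : connect (edge_rel E') x y.
  by apply: connect_trans (E'c _ (all y)); rewrite connect_edgeC; exact/E'c/all.
have [E'' sub tE''] := connected_subtree E'2 E'c'.
apply: (@leq_trans (tree_weight E)) => //.
rewrite big_set0 mul1n in E'w; apply: leq_trans E'w.
apply: (leq_trans (spread_min _ tE'')); rewrite /tree_weight.
rewrite [leqLHS]big_mkcond [leqRHS]big_mkcond; apply: leq_prod => e _.
case: ifP => [/(fintype.subsetP sub) -> //|_].
by case: ifP => // _; exact: edge_weight_gt0.
Qed.

(** Whatever the enumeration [p], [q], [r], [s], the spread is, up to a constant,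
    the least weight of a tree in which each point is joined to an earlier one.
    The two halves of this turn sums over trees into sums of products of
    brackets along an enumeration chosen to suit the order of summation.  The
    constant [512] is [2 ^ (3 ^ 2)]. *)
Lemma spread4_le p q r s u v : u \in [:: p; q] -> v \in [:: p; q; r] ->
  spread [fset p; q; r; s]%fset <= bracket p q * bracket u r * bracket v s.
Proof.
move=> us vs; set W := [fset p; q; r; s]%fset.
have [pW qW rW sW] : [/\ p \in W, q \in W, r \in W & s \in W].
  by rewrite !inE !eqxx ?orbT.
have [|+ _] := @spread_chain W [` pW]%fset [:: [` qW]; [` rW]; [` sW]]%fset.
  by move=> x; have := valP x; rewrite !inE -!val_eqE /= -!orbA.
move=> /leq_trans; apply; rewrite /= muln1 -mulnA.
set b := (X in near X).
apply: leq_mul; first exact: (near_le b [` qW]%fset (mem_head [` pW]%fset [::])).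
apply: leq_mul.
  have [u' u's <-] : exists2 u', u' \in [:: [` pW]; [` qW]]%fset & val u' = u.
    by move: us; rewrite !inE => /orP[]/eqP->;
      [exists [` pW]%fset|exists [` qW]%fset];
      rewrite ?inE ?eqxx ?orbT.
  exact: (near_le b [` rW]%fset u's).
have [v' v's <-] : exists2 v', v' \in [:: [` pW]; [` rW]; [` qW]]%fset & val v' = v.
  by move: vs; rewrite !inE => /or3P[]/eqP->;
    [exists [` pW]%fset|exists [` qW]%fset|exists [` rW]%fset];
    rewrite ?inE ?eqxx ?orbT.
exact: (near_le b [` sW]%fset v's).
Qed.

Lemma spread4_ge p q r s : exists u v, [/\ u \in [:: p; q], v \in [:: p; q; r] &
  bracket p q * bracket u r * bracket v s <= 512 * spread [fset p; q; r; s]%fset].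
Proof.
set W := [fset p; q; r; s]%fset.
have [pW qW rW sW] : [/\ p \in W, q \in W, r \in W & s \in W].
  by rewrite !inE !eqxx ?orbT.
have [|_] := @spread_chain W [` pW]%fset [:: [` qW]; [` rW]; [` sW]]%fset.
  by move=> x; have := valP x; rewrite !inE -!val_eqE /= -!orbA.
rewrite /= muln1; set b := (X in near X) => le.
have [u' +] := nearP b [` pW]%fset [::] [` qW]%fset; rewrite inE => /eqP-> e0.
have [u us e1] := nearP b [` pW]%fset [:: [` qW]]%fset [` rW]%fset.
have [v vs e2] := nearP b [` pW]%fset [:: [` rW]; [` qW]]%fset [` sW]%fset.
exists (val u), (val v); split.
- by move: us; rewrite !inE => /orP[]/eqP->; rewrite eqxx ?orbT.
- by move: vs; rewrite !inE => /or3P[]/eqP->; rewrite eqxx ?orbT.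
by apply: leq_trans le; rewrite e0 e1 e2 mulnA.
Qed.

Lemma spread4_gt0 p q r s : 0 < spread [fset p; q; r; s]%fset.
Proof.
have [u [v [_ _ le]]] := spread4_ge p q r s.
by case: (spread _) le => //; rewrite muln0 leqn0.
Qed.

End Bracket.

(** * Power laws on the lattice *)

(** Locked, so that unification never compares two values by unfolding lattice
    distances. *)
HB.lock Definition decay (R : realType) (d : nat) (a : R) (x y : Zd d) : R :=
  (bracket x y)%:R `^ (- a).

Section Decay.
Variables (R : realType) (d : nat).
Implicit Types (a b : R) (u v x y z : Zd d).

Lemma decay_gt0 a x y : 0 < decay a x y.
Proof. by rewrite decay.unlock powR_gt0 // ltr0n. Qed.

Lemma decay_ge0 a x y : 0 <= decay a x y.
Proof. by rewrite decay.unlock powR_ge0. Qed.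

Lemma decayC a x y : decay a x y = decay a y x.
Proof. by rewrite decay.unlock bracketC. Qed.

Lemma decayxx a x : decay a x x = 1.
Proof. by rewrite decay.unlock bracketxx powR1. Qed.

Lemma decay0 x y : decay (0 : R) x y = 1.
Proof. by rewrite decay.unlock oppr0 powRr0. Qed.

Lemma decayD a b x y : decay a x y * decay b x y = decay (a + b) x y.
Proof. by rewrite decay.unlock opprD powRD // pnatr_eq0 implybT. Qed.

Lemma decay_exponent_le a b x y : a <= b -> decay b x y <= decay a x y.
Proof. by move=> ab; rewrite decay.unlock ler_powR ?ler1n // lerN2. Qed.

Lemma decay_le1 a x y : 0 <= a -> decay a x y <= 1.
Proof.
move=> a0; rewrite decay.unlock -[leRHS](powRr0 (bracket x y)%:R).
by rewrite ler_powR ?ler1n // oppr_le0.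
Qed.

Lemma powRN_le a (m n k : nat) : 0 <= a -> (0 < m)%N -> (0 < n)%N -> (0 < k)%N ->
  (m <= k * n)%N -> n%:R `^ (- a) <= k%:R `^ a * m%:R `^ (- a) :> R.
Proof.
move=> a0 m0 n0 k0 le; rewrite !powRN mulrC.
rewrite ler_pdivlMl ?powR_gt0 ?ltr0n // ler_pdivrMr ?powR_gt0 ?ltr0n // -powRM //.
by rewrite ge0_ler_powR // ?nnegrE // -natrM ler_nat.
Qed.

Lemma powRN_antitone a (m n : nat) : 0 <= a -> (0 < m)%N -> (m <= n)%N ->
  n%:R `^ (- a) <= m%:R `^ (- a) :> R.
Proof.
move=> a0 m0 mn; have := @powRN_le a m n 1 a0 m0 (leq_trans m0 mn) isT.
by rewrite powR1 mul1r mul1n; exact.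
Qed.

Lemma decay_comparison a k x y u v : 0 <= a -> (0 < k)%N ->
  (bracket x y <= k * bracket u v)%N -> decay a u v <= k%:R `^ a * decay a x y.
Proof. by rewrite decay.unlock => *; exact: powRN_le. Qed.

Lemma decay_le a x y u v : 0 <= a -> (bracket x y <= bracket u v)%N ->
  decay a u v <= decay a x y.
Proof. by rewrite decay.unlock => a0; exact: powRN_antitone. Qed.

End Decay.

(** * Boxes and the number of lattice points in them *)

Section Boxes.
Variable d : nat.
Implicit Types (u x y z : Zd d) (n : nat).

Definition box x n : seq (Zd d) :=
  [seq x + \row_i ((k ord0 i)%:Z - n%:Z) | k : 'rV['I_(n.*2.+1)]_d].

Lemma size_box x n : size (box x n) = (n.*2.+1 ^ d)%N.
Proof. by rewrite size_map -cardE card_mx mul1n card_ord. Qed.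

Lemma box_uniq x n : uniq (box x n).
Proof.
rewrite map_inj_uniq ?enum_uniq // => k l /addrI /rowP e; apply/rowP => i.
by move: (e i); rewrite !mxE => /addIr [] /val_inj.
Qed.

Lemma mem_box x n y : (y \in box x n) = [forall i, `|x ord0 i - y ord0 i| <= n]%N.
Proof.
apply/mapP/forallP => [[k _ ->] i|H].
  rewrite !mxE opprD addrA subrr add0r abszN.
  by move: (nat_of_ord (k ord0 i)) (ltn_ord (k ord0 i)) => j; lia.
exists (\row_i inord (absz (y ord0 i - x ord0 i + n%:Z))); rewrite ?mem_enum //.
apply/rowP => i; rewrite !mxE; move: (H i).
by move: (x ord0 i) (y ord0 i) => a c ac; rewrite inordK; lia.
Qed.

Lemma box_sub_bracket x n y : y \in box x n -> (bracket x y <= 1 + d * n)%N.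
Proof.
rewrite mem_box => /forallP H; rewrite leq_add2l.
apply: leq_trans (leq_sum _ (fun i _ => H i)) _.
by rewrite sum_nat_const card_ord.
Qed.

Lemma bracket_sub_box x n y : (bracket x y <= n.+1)%N -> y \in box x n.
Proof.
rewrite mem_box /bracket add1n ltnS => H; apply/forallP => i.
by apply: leq_trans H; rewrite (bigD1 i) //= leq_addr.
Qed.

Lemma size_ball x m (s : seq (Zd d)) : uniq s -> (0 < m)%N ->
  (forall y, y \in s -> (bracket x y <= m)%N) -> (size s <= (3 * m) ^ d)%N.
Proof.
case: m => // m us _ H; apply: (@leq_trans (m.*2.+1 ^ d)%N).
  by rewrite -(size_box x); apply: uniq_leq_size => // y /H; exact: bracket_sub_box.
by case: (d) => [//|e]; rewrite leq_exp2r //; lia.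
Qed.

End Boxes.

(** * Sums of power laws *)

Lemma sum_le_incl (R : realType) (I : eqType) (f : I -> R) (s t : seq I) :
  (forall y, 0 <= f y) -> uniq s -> {subset s <= t} ->
  \sum_(y <- s) f y <= \sum_(y <- t) f y.
Proof.
move=> f0 us st.
have -> : \sum_(y <- s) f y = \sum_(y <- undup t | y \in s) f y.
  rewrite -[RHS]big_filter; apply: perm_big; apply: uniq_perm => //.
    by rewrite filter_uniq ?undup_uniq.
  by move=> y; rewrite mem_filter mem_undup; case: (boolP (y \in s)) => //= /st ->.
apply: (@le_trans _ _ (\sum_(y <- undup t) f y)).
  by rewrite big_mkcond; apply: ler_sum => y _; case: ifP.
elim: t {st} => //= y t IH; rewrite big_cons; case: ifP => _.
  by apply: le_trans IH _; rewrite lerDr.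
by rewrite big_cons lerD2l.
Qed.

Section LatticeSums.
Variables (R : realType) (d : nat).
Implicit Types (a b : R) (u v x y z : Zd d) (s : seq (Zd d)).

(** There are at most [6 ^ d * 2 ^ (j d)] points in the dyadic shell
    [2 ^ j <= bracket u y < 2 ^ (j + 1)], and each contributes at most
    [2 ^ (- j a)]. *)
Lemma shell_sum_le a u (j : nat) s : 0 <= a -> uniq s ->
  \sum_(y <- s | trunc_log 2 (bracket u y) == j) decay a u y
    <= 6 ^+ d * (2 `^ (d%:R - a)) ^+ j.
Proof.
move=> a0 us; rewrite -big_filter; set t := [seq _ <- _ | _].
have tP y : y \in t -> (2 ^ j <= bracket u y < 2 ^ j.+1)%N.
  by rewrite mem_filter => /andP[/eqP <- _]; exact: trunc_log_bounds.
apply: (@le_trans _ _ (\sum_(y <- t) (2 ^ j)%:R `^ (- a))).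
  rewrite big_seq [leRHS]big_seq; apply: ler_sum => y /tP /andP[le _].
  rewrite decay.unlock.
  by apply: powRN_antitone; rewrite ?expn_gt0.
rewrite big_const_seq count_predT iter_addr_0 -[leLHS]mulr_natr mulrC.
have : (size t <= (3 * 2 ^ j.+1) ^ d)%N.
  apply: (@size_ball _ u); rewrite ?filter_uniq // ?expn_gt0 // => y /tP.
  by case/andP => _ /ltnW.
rewrite expnS mulnA -(ler_nat R) => /(ler_wpM2r (powR_ge0 (2 ^ j)%:R (- a))).
move=> /le_trans; apply.
rewrite expnMn natrM natrX -mulrA ler_pM2l ?exprn_gt0 //.
rewrite -!powR_mulrn ?powR_ge0 // -powRrM natrX -powR_mulrn ?ler0n //.
rewrite natrX -powR_mulrn ?powR_ge0 ?ler0n //.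
rewrite -!powRrM -powRD ?pnatr_eq0 ?implybT //.
by rewrite le_eqVlt; apply/orP; left; apply/eqP; congr powR; ring.
Qed.

Lemma sum_le_shells a u s (P : pred (Zd d)) (J : seq nat) : uniq J ->
  (forall y, y \in s -> P y -> trunc_log 2 (bracket u y) \in J) ->
  \sum_(y <- s | P y) decay a u y <=
  \sum_(j <- J) \sum_(y <- s | trunc_log 2 (bracket u y) == j) decay a u y.
Proof.
move=> uJ sJ; under [leRHS]eq_bigr do rewrite big_mkcond.
rewrite exchange_big /= big_mkcond /= [leLHS]big_seq [leRHS]big_seq.
apply: ler_sum => y ys; case: ifPn => Py; last first.
  by apply: sumr_ge0 => j _; case: ifP => // _; exact: decay_ge0.
rewrite (bigD1_seq _ (sJ y ys Py) uJ) /= eqxx lerDl.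
by apply: sumr_ge0 => j _; case: ifP => // _; exact: decay_ge0.
Qed.

(** The shells form a geometric series of ratio [2 ^ (d - a) > 1], which is
    dominated by its last term. *)
Lemma near_sum_le a : 0 <= a < d%:R -> exists2 C : R, 0 < C &
  forall u m s, uniq s -> (0 < m)%N ->
    \sum_(y <- s | (bracket u y <= m)%N) decay a u y <= C * m%:R `^ (d%:R - a).
Proof.
case/andP=> a0 ad; set rho : R := 2 `^ (d%:R - a).
have rho1 : 1 < rho.
  rewrite -(powRr0 2) /rho /powR pnatr_eq0 /= ltr_expR mul0r.
  by rewrite mulr_gt0 ?subr_gt0 ?ln_gt0 ?ltr1n.
exists (6 ^+ d * (rho / (rho - 1))).
  by rewrite mulr_gt0 ?exprn_gt0 // divr_gt0 ?subr_gt0 // (lt_trans _ rho1).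
move=> u m s us m0; set J := trunc_log 2 m.
apply: le_trans (@sum_le_shells _ u s _ (index_iota 0 J.+1) (iota_uniq _ _) _) _.
  move=> y _ ym; rewrite mem_index_iota /= ltnS.
  exact: leq_trunc_log.
apply: le_trans (ler_sum _ (fun j _ => shell_sum_le u j a0 us)) _.
rewrite -mulr_sumr -mulrA ler_pM2l ?exprn_gt0 //.
have -> : \sum_(0 <= j < J.+1) rho ^+ j = (rho ^+ J.+1 - 1) / (rho - 1).
  by rewrite subrX1 big_mkord mulrC mulKf // subr_eq0 gt_eqF.
rewrite mulrAC ler_pM2r ?invr_gt0 ?subr_gt0 // exprS.
apply: (@le_trans _ _ (rho * rho ^+ J)); first by rewrite lerBlDr lerDl.
rewrite ler_pM2l ?(lt_trans _ rho1) //.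
rewrite -powR_mulrn ?powR_ge0 // -powRrM mulrC powRrM powR_mulrn //.
rewrite ge0_ler_powR ?nnegrE ?subr_ge0 ?(ltW ad) // ?exprn_ge0 //.
by rewrite -natrX ler_nat; exact: trunc_logP.
Qed.

(** The shells form a geometric series of ratio [2 ^ (d - a) < 1], which is
    dominated by its first term. *)
Lemma far_sum_le a : d%:R < a -> exists2 C : R, 0 < C &
  forall u m s, uniq s -> (0 < m)%N ->
    \sum_(y <- s | (m <= bracket u y)%N) decay a u y <= C * m%:R `^ (d%:R - a).
Proof.
move=> ad; have a0 : 0 <= a by rewrite (le_trans _ (ltW ad)).
set rho : R := 2 `^ (d%:R - a).
have rho0 : 0 < rho by rewrite powR_gt0.
have rho1 : rho < 1.
  rewrite -(powRr0 2) /rho /powR pnatr_eq0 /= ltr_expR mul0r.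
  by rewrite nmulr_rlt0 ?subr_lt0 ?ln_gt0 ?ltr1n.
exists (6 ^+ d * (rho^-1 / (1 - rho))).
  by rewrite mulr_gt0 ?exprn_gt0 // divr_gt0 ?subr_gt0 ?invr_gt0.
move=> u m s us m0; set J := trunc_log 2 m.
set N := (\max_(y <- s) trunc_log 2 (bracket u y)).+1.
apply: le_trans (@sum_le_shells _ u s _ (index_iota J N) (iota_uniq _ _) _) _.
  move=> y ys ym; rewrite mem_index_iota leq_trunc_log //= ltnS.
  exact: leq_bigmax_seq.
apply: le_trans (ler_sum _ (fun j _ => shell_sum_le u j a0 us)) _.
rewrite -mulr_sumr -mulrA ler_pM2l ?exprn_gt0 //.
have geo : \sum_(J <= j < N) rho ^+ j <= rho ^+ J / (1 - rho).
  rewrite -{1}[J]add0n big_addn; under eq_bigr do rewrite exprD.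
  rewrite -mulr_suml mulrC ler_pM2l ?exprn_gt0 // big_mkord.
  rewrite -[leRHS]mul1r ler_pdivlMr ?subr_gt0 // mulrC.
  have := subrX1 rho (N - J); set S := \sum_(i < _) _ => e.
  have := exprn_ge0 (N - J) (ltW rho0); move: (rho ^+ (N - J)) e => X e X0; lra.
apply: le_trans geo _; rewrite mulrAC ler_pM2r ?invr_gt0 ?subr_gt0 //.
rewrite ler_pdivlMl // -exprS.
rewrite -powR_mulrn ?powR_ge0 // -powRrM mulrC powRrM powR_mulrn // -natrX.
rewrite -opprB; apply: powRN_antitone; rewrite ?subr_ge0 ?(ltW ad) //.
by apply: ltnW; exact: trunc_log_ltn.
Qed.

(** A point [y] at least as close to [u] as to [v] is at distance at least half of
    [bracket u v] from [v].  So either [y] lies within [bracket u v] of [u], and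
    the second factor is, up to a constant, at most [decay b u v]; or it is
    farther, and the product is at most [decay (a + b) u y], whose exponent
    exceeds [d]. *)
Lemma convolution_le a b : 0 <= a < d%:R -> 0 <= b < d%:R -> d%:R < a + b ->
  exists2 C : R, 0 < C & forall u v s, uniq s ->
    \sum_(y <- s) decay a u y * decay b y v <= C * decay (a + b - d%:R) u v.
Proof.
move=> ad bd abd.
have [Ca Ca0 nearA] := near_sum_le ad; have [Cb Cb0 nearB] := near_sum_le bd.
have [Cf Cf0 far] := far_sum_le abd.
have /andP[a0 _] := ad; have /andP[b0 _] := bd.
pose D := 2 `^ b * Ca + 2 `^ a * Cb + Cf + Cf : R.
exists D.
  by rewrite /D !addr_gt0 // mulr_gt0 ?powR_gt0.
move=> u v s us; set m := bracket u v.
have half u1 v1 y : (bracket u1 y <= bracket y v1)%N ->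
    (bracket u1 v1 <= 2 * bracket y v1)%N.
  by have := bracket_triangle u1 v1 y; lia.
have one a1 b1 u1 v1 y : 0 <= a1 -> 0 <= b1 -> (bracket u1 y <= bracket y v1)%N ->
  decay a1 u1 y * decay b1 y v1 <=
   (if (bracket u1 y <= bracket u1 v1)%N
    then 2 `^ b1 * decay b1 u1 v1 * decay a1 u1 y else 0) +
   (if (bracket u1 v1 <= bracket u1 y)%N then decay (a1 + b1) u1 y else 0).
  move=> a10 b10 le.
  have [mle|mgt] := leqP (bracket u1 y) (bracket u1 v1).
    rewrite -[leLHS]addr0 lerD //; last by case: ifP => // _; exact: decay_ge0.
    rewrite mulrC ler_wpM2r ?decay_ge0 //.
    by apply: decay_comparison => //; exact: half.
  rewrite (ltnW mgt) add0r -decayD ler_wpM2l ?decay_ge0 //.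
  exact: decay_le.
have pt y : decay a u y * decay b y v <=
   ((if (bracket u y <= m)%N then 2 `^ b * decay b u v * decay a u y else 0) +
    (if (m <= bracket u y)%N then decay (a + b) u y else 0)) +
   ((if (bracket v y <= m)%N then 2 `^ a * decay a u v * decay b v y else 0) +
    (if (m <= bracket v y)%N then decay (a + b) v y else 0)).
  have [le|/ltnW le] := leqP (bracket u y) (bracket y v).
    apply: le_trans (one a b u v y a0 b0 le) _.
    rewrite lerDl addr_ge0 //; case: ifP => // _; rewrite ?decay_ge0 //.
    by rewrite !mulr_ge0 ?powR_ge0 ?decay_ge0.
  rewrite mulrC (decayC b) (decayC a u).
  have {}le : (bracket v y <= bracket y u)%N by rewrite bracketC (bracketC y u).
  apply: le_trans (one b a v u y b0 a0 le) _.
  rewrite (addrC b) (bracketC v u) -/m (decayC a v) lerDr.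
  by rewrite addr_ge0 //; case: ifP => // _; rewrite ?mulr_ge0 ?powR_ge0 ?decay_ge0.
apply: le_trans (ler_sum _ (fun y _ => pt y)) _.
rewrite !big_split -!big_mkcond /= -!mulr_sumr /D.
have m0 : (0 < m)%N by [].
have := nearA u m s us m0; have := nearB v m s us m0.
have := far u m s us m0; have := far v m s us m0.
have -> : decay (a + b - d%:R) u v = m%:R `^ (d%:R - (a + b)) by rewrite decay.unlock opprB.
have eab : m%:R `^ (d%:R - (a + b)) = decay b u v * m%:R `^ (d%:R - a).
  by rewrite decay.unlock -powRD ?pnatr_eq0 ?implybT //; congr powR; ring.
have eba : m%:R `^ (d%:R - (a + b)) = decay a u v * m%:R `^ (d%:R - b).
  by rewrite decay.unlock -powRD ?pnatr_eq0 ?implybT //; congr powR; ring.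
move=> h1 h2 h3 h4; rewrite !mulrDl.
have g3 : 2 `^ a * decay a u v * \sum_(i <- s | (bracket v i <= m)%N) decay b v i <=
   2 `^ a * Cb * (decay a u v * m%:R `^ (d%:R - b)).
  rewrite -!mulrA ler_pM2l ?powR_gt0 // mulrCA ler_pM2l ?decay_gt0 //.
have g4 : 2 `^ b * decay b u v * \sum_(i <- s | (bracket u i <= m)%N) decay a u i <=
   2 `^ b * Ca * (decay b u v * m%:R `^ (d%:R - a)).
  rewrite -!mulrA ler_pM2l ?powR_gt0 // mulrCA ler_pM2l ?decay_gt0 //.
rewrite -eba in g3; rewrite -eab in g4; lra.
Qed.

End LatticeSums.

(** * Sums over pairs of intermediate points *)

HB.lock Definition spread_decay (R : realType) (d : nat) (a : R) (p q r w : Zd d) : R :=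
  (spread [fset p; q; r; w]%fset)%:R `^ (- a).

HB.lock Definition decays
    (R : realType) (d : nat) (a : R) (U : seq (Zd d)) (y : Zd d) : R :=
  \sum_(u <- U) decay a u y.

Section PairSums.
Variables (R : realType) (d : nat).
Implicit Types (a b : R) (p q r u v w x y z : Zd d) (U V s t : seq (Zd d)).

Lemma decays_ge0 a U y : 0 <= decays a U y.
Proof. by rewrite decays.unlock; apply: sumr_ge0 => u _; exact: decay_ge0. Qed.

Lemma decays1 a u y : decays a [:: u] y = decay a u y.
Proof. by rewrite decays.unlock big_seq1. Qed.

Lemma decay_le_decays a U u y : u \in U -> decay a u y <= decays a U y.
Proof.
move=> uU; rewrite decays.unlock (big_rem u uU) /= lerDl.
by apply: sumr_ge0 => v _; exact: decay_ge0.
Qed.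

Lemma spread_decay_gt0 a p q r w : 0 < spread_decay a p q r w.
Proof. by rewrite spread_decay.unlock powR_gt0 // ltr0n spread4_gt0. Qed.

Lemma spread_decay_eq a p q r w p' q' r' w' :
  [:: p; q; r; w] =i [:: p'; q'; r'; w'] ->
  spread_decay a p q r w = spread_decay a p' q' r' w'.
Proof.
move=> e; rewrite spread_decay.unlock.
have -> // : [fset p; q; r; w]%fset = [fset p'; q'; r'; w']%fset.
by apply/fsetP => v; have := e v; rewrite !inE -!orbA.
Qed.

(** The power of a minimum of brackets is at most the sum of the powers, so that a
    sum over the last point [w] of the enumeration becomes a sum of power laws. *)
Lemma spread_decay_le a : 0 <= a -> exists2 C : R, 0 < C &
  forall p q r w, spread_decay a p q r w <=
    C * (decay a p q * decays a [:: p; q] r * decays a [:: p; q; r] w).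
Proof.
move=> a0; set k := 512%:R `^ a : R; have k0 : 0 < k by rewrite powR_gt0 ?ltr0n.
exists k => // p q r w; have [u [v [us vs le]]] := spread4_ge p q r w.
apply: (@le_trans _ _ (k * (decay a p q * decay a u r * decay a v w))).
  rewrite spread_decay.unlock decay.unlock -!powRM ?ler0n // -!natrM.
  by apply: powRN_le => //; exact: spread4_gt0.
rewrite ler_pM2l // ler_pM ?mulr_ge0 ?decay_ge0 ?decay_le_decays //.
by rewrite ler_pM2l ?decay_gt0 // decay_le_decays.
Qed.

Lemma tree_decay_le a p q r w u v : 0 <= a -> u \in [:: p; q] -> v \in [:: p; q; r] ->
  decay a p q * decay a u r * decay a v w <= spread_decay a p q r w.
Proof.
move=> a0 us vs; rewrite spread_decay.unlock decay.unlock -!powRM // -!natrM.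
by apply: powRN_antitone => //; [exact: spread4_gt0|exact: spread4_le].
Qed.

(** Of the two points [x] and [z], the one farther from [y] is at distance at
    least half of [bracket x z] from it; as [g <= a], the larger exponent may be
    moved to the nearer one. *)
Lemma decay_exchange a g x y z : 0 <= g <= a ->
  decay a z y * decay g x y <= 2 `^ g * decay g x z * (decay a z y + decay a x y).
Proof.
move=> /andP[g0 ga]; have tri := bracket_triangle x z y.
have [le|/ltnW le] := leqP (bracket z y) (bracket x y).
  have le2 : decay g x y <= 2 `^ g * decay g x z.
    by apply: decay_comparison => //; rewrite (bracketC y) in tri; lia.
  rewrite mulrC; apply: ler_pM; rewrite ?decay_ge0 //.
  by rewrite lerDl decay_ge0.
have le2 : decay g z y <= 2 `^ g * decay g x z.
  by apply: decay_comparison => //; rewrite (bracketC y) in tri; lia.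
rewrite -{1}(subrK g a) -decayD mulrAC mulrC.
apply: ler_pM => //; rewrite ?mulr_ge0 ?decay_ge0 //.
apply: (@le_trans _ _ (decay a x y)); last by rewrite lerDr decay_ge0.
have -> : decay a x y = decay (a - g) x y * decay g x y by rewrite decayD subrK.
rewrite ler_pM2r ?decay_gt0 //.
by apply: decay_le => //; rewrite subr_ge0.
Qed.

Lemma sum_decays_le a b U V s (H : R) :
  (forall p q, p \in U -> q \in V -> \sum_(y <- s) decay a p y * decay b y q <= H) ->
  \sum_(y <- s) decays a U y * decays b V y <= (size U * size V)%:R * H.
Proof.
move=> le; under eq_bigr do rewrite decays.unlock mulr_suml.
rewrite exchange_big /= natrM -mulrA mulr_natl -iter_addr_0 -(count_predT U) -big_const_seq.
rewrite big_seq [leRHS]big_seq; apply: ler_sum => u uU.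
under eq_bigr do rewrite mulr_sumr.
rewrite exchange_big /= mulr_natl -iter_addr_0 -(count_predT V) -big_const_seq.
rewrite big_seq [leRHS]big_seq; apply: ler_sum => v vV.
by under eq_bigr do rewrite (decayC b); exact: le.
Qed.

Lemma decays_convolution_le a b : 0 <= a < d%:R -> 0 <= b < d%:R -> d%:R < a + b ->
  exists2 C : R, 0 < C & forall U V s, uniq s ->
    \sum_(y <- s) decays a U y * decays b V y <=
    C * \sum_(u <- U) \sum_(v <- V) decay (a + b - d%:R) u v.
Proof.
move=> ad bd abd; have [C C0 conv] := convolution_le ad bd abd.
exists C => // U V s us.
under eq_bigr do rewrite decays.unlock mulr_suml; rewrite exchange_big mulr_sumr.
apply: ler_sum => u _; under eq_bigr do rewrite mulr_sumr.
rewrite exchange_big mulr_sumr; apply: ler_sum => v _ /=.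
by under eq_bigr do rewrite (decayC b); exact: conv.
Qed.

(** The spread is enumerated as [z], [w], [v], [u].  The sum over [u] is then a
    convolution, which leaves factors [decay g x p] with [p] among [z], [w], [v].
    When [p] is [v] this factor depends on the remaining summation variable, and
    [decay_exchange] trades it for a constant one.  After the convolution over
    [v], every term is the weight of a tree on the four points, all exponents
    being at least [g]. *)
Lemma sum_decay_spread_le a b : 0 <= a < d%:R -> 0 <= b < d%:R ->
  d%:R < a + b -> exists2 C : R, 0 < C &
  forall x y z w s t, uniq s -> uniq t ->
    \sum_(u <- s) \sum_(v <- t) decay a x u * decay a y v * spread_decay b u z v w
    <= C * spread_decay (a + b - d%:R) x z y w.
Proof.
move=> ad bd abd; set g := a + b - d%:R.
have [/andP[a0 _] /andP[b0 _]] := (ad, bd).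
have g0 : 0 <= g by rewrite subr_ge0 ltW.
have gb : g <= b by rewrite /g lerBlDr addrC lerD2l; case/andP: ad => _ /ltW.
have [k k0 spread_le] := spread_decay_le b0.
have [c c0 conv] := decays_convolution_le ad bd abd.
(* There are [2 * 3] trees in the end. *)
exists (k * c * (1 + 2 `^ g) * c * 6).
  by rewrite !mulr_gt0 ?powR_gt0 // addr_gt0 ?powR_gt0.
move=> x y z w s t us ut.
rewrite exchange_big /=.
apply: (@le_trans _ _ (\sum_(v <- t) k * decay b z w *
    (decay a y v * decays b [:: z; w] v) *
    \sum_(u <- s) decays a [:: x] u * decays b [:: z; w; v] u)).
  apply: ler_sum => v _; rewrite mulr_sumr; apply: ler_sum => u _.
  rewrite (@spread_decay_eq _ u z v w z w v u); last first.
    by move=> p; rewrite !inE; do 4 case: (_ == _).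
  have := spread_le z w v u.
  move=> /(ler_wpM2l (mulr_ge0 (decay_ge0 a x u) (decay_ge0 a y v))) /le_trans; apply.
  rewrite decays1 le_eqVlt; apply/orP; left; apply/eqP.
  move: (decay a x u) (decay a y v) (decay b z w) (decays b _ v) (decays b _ u).
  by move=> *; ring.
have inner v : \sum_(u <- s) decays a [:: x] u * decays b [:: z; w; v] u <=
    c * (decay g x z + decay g x w + decay g x v).
  by apply: le_trans (conv _ _ _ us) _; rewrite !(big_cons, big_nil) !addr0 addrA.
apply: (@le_trans _ _ (\sum_(v <- t) k * c * (1 + 2 `^ g) * decay b z w *
    (decay g x z + decay g x w) * (decays a [:: y] v * decays b [:: z; w; x] v))).
  apply: ler_sum => v _.
  apply: (le_trans (ler_wpM2l _ (inner v))).
    by rewrite !mulr_ge0 ?(ltW k0) ?decay_ge0 ?decays_ge0.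
  have ez := @decay_exchange b g x v z; have ew := @decay_exchange b g x v w.
  rewrite g0 gb in ez ew; move: (ez isT) (ew isT) => {}ez {}ew.
  rewrite decays.unlock !(big_cons, big_nil) !addr0.
  rewrite [leRHS](_ : _ = k * decay b z w * decay a y v * c *
    ((1 + 2 `^ g) * (decay g x z + decay g x w) *
       (decay b z v + (decay b w v + decay b x v)))); last first.
    move: (decay b z w) (decay a y v) (decay g x z) (decay g x w).
    by move: (decay b z v) (decay b w v) (decay b x v) => *; ring.
  rewrite [leLHS](_ : _ = k * decay b z w * decay a y v * c *
    ((decay b z v + decay b w v) *
       (decay g x z + decay g x w + decay g x v))); last first.
    move: (decay b z w) (decay a y v) (decay g x z) (decay g x w) (decay g x v).
    by move: (decay b z v) (decay b w v) => *; ring.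
  apply: ler_wpM2l; first by rewrite !mulr_ge0 ?decay_ge0 ?(ltW k0) ?(ltW c0).
  move: ez ew; have := powR_ge0 2 g.
  have := decay_ge0 b z v; have := decay_ge0 b w v; have := decay_ge0 b x v.
  have := decay_ge0 g x z; have := decay_ge0 g x w.
  move: (decay b z v) (decay b w v) (decay b x v) => Z W X.
  move: (decay g x z) (decay g x w) (decay g x v) (2 `^ g) => A B G e.
  move=> A0 B0 X0 W0 Z0 e0 h1 h2.
  have : 0 <= (A + B) * X + e * (A * W) + e * (B * Z).
    by rewrite !addr_ge0 ?mulr_ge0 ?addr_ge0.
  rewrite !mulrDr !mulrDl in h1 h2 *; lra.
rewrite -mulr_sumr.
apply: le_trans (ler_wpM2l _ (conv [:: y] [:: z; w; x] t ut)) _.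
  by rewrite !mulr_ge0 ?(ltW k0) ?(ltW c0) ?addr_ge0 ?powR_ge0 ?decay_ge0.
rewrite big_seq1 !big_cons big_nil addr0.
have tree u v : u \in [:: z; w] -> v \in [:: z; w; x] ->
    decay b z w * decay g u x * decay g v y <= spread_decay g x z y w.
  move=> uu vv; rewrite (@spread_decay_eq _ x z y w z w x y); last first.
    by move=> p; rewrite !inE; do 4 case: (_ == _).
  apply: le_trans (tree_decay_le y g0 uu vv).
  by rewrite -!mulrA ler_wpM2r ?mulr_ge0 ?decay_ge0 // decay_exponent_le.
rewrite [leLHS](_ : _ = k * c * (1 + 2 `^ g) * c *
  (decay b z w * decay g z x * decay g z y + decay b z w * decay g z x * decay g w y +
   decay b z w * decay g z x * decay g x y + decay b z w * decay g w x * decay g z y +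
   decay b z w * decay g w x * decay g w y + decay b z w * decay g w x * decay g x y));
  last by rewrite !(decayC g _ y) (decayC g w x) (decayC g z x); ring.
rewrite -[leRHS]mulrA ler_wpM2l ?mulr_ge0 ?addr_ge0 ?powR_ge0 ?(ltW c0) ?(ltW k0) //.
have t1 := tree z z; have t2 := tree z w; have t3 := tree z x.
have t4 := tree w z; have t5 := tree w w; have t6 := tree w x.
move: t1 t2 t3 t4 t5 t6; rewrite !inE !eqxx ?orbT => t1 t2 t3 t4 t5 t6.
have := t1 isT isT; have := t2 isT isT; have := t3 isT isT.
have := t4 isT isT; have := t5 isT isT; have := t6 isT isT; lra.
Qed.

(** Here the spreads are enumerated as [x], [y], [v], [u] and [z], [w], [v], [u].
    The sum over [u] is bounded by a constant, and the convolution over [v]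
    produces the edge that links the edges [x y] and [z w] into a tree. *)
Lemma sum_spread_spread_le a b : 0 <= a < d%:R -> 0 <= b < d%:R ->
  d%:R < a + b -> exists2 C : R, 0 < C &
  forall x y z w s t, uniq s -> uniq t ->
    \sum_(u <- s) \sum_(v <- t) spread_decay a x u y v * spread_decay b u z v w
    <= C * spread_decay (a + b - d%:R) x z y w.
Proof.
move=> ad bd abd; set g := a + b - d%:R.
have [/andP[a0 _] /andP[b0 _]] := (ad, bd).
have g0 : 0 <= g by rewrite subr_ge0 ltW.
have ga : g <= a by rewrite /g lerBlDr lerD2l; case/andP: bd => _ /ltW.
have gb : g <= b by rewrite /g lerBlDr addrC lerD2l; case/andP: ad => _ /ltW.
have [ka ka0 spread_le_a] := spread_decay_le a0.
have [kb kb0 spread_le_b] := spread_decay_le b0.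
have [c c0 conv] := decays_convolution_le ad bd abd.
have [c' c'0 conv1] := convolution_le ad bd abd.
(* [9 = 3 * 3] terms in the sum over [u], then [4 = 2 * 2] linking edges. *)
exists (ka * kb * (c' * 9) * c * 4); first by rewrite !mulr_gt0.
move=> x y z w s t us ut; rewrite exchange_big /=.
have inner v : \sum_(u <- s) decays a [:: x; y; v] u * decays b [:: z; w; v] u <= 9%:R * c'.
  apply: (sum_decays_le (U := [:: x; y; v]) (V := [:: z; w; v])) => p q _ _.
  by apply: le_trans (conv1 p q s us) _; rewrite -[leRHS]mulr1 ler_pM2l // decay_le1.
apply: (@le_trans _ _ (\sum_(v <- t) ka * kb * decay a x y * decay b z w *
    (decays a [:: x; y] v * decays b [:: z; w] v) *
    \sum_(u <- s) decays a [:: x; y; v] u * decays b [:: z; w; v] u)).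
  apply: ler_sum => v _; rewrite mulr_sumr; apply: ler_sum => u _.
  rewrite (@spread_decay_eq _ u z v w z w v u); last first.
    by move=> p; rewrite !inE; do 4 case: (_ == _).
  rewrite (@spread_decay_eq _ x u y v x y v u); last first.
    by move=> p; rewrite !inE; do 4 case: (_ == _).
  apply: le_trans (ler_pM _ _ (spread_le_a x y v u) (spread_le_b z w v u)) _;
    try exact/ltW/spread_decay_gt0.
  rewrite le_eqVlt; apply/orP; left; apply/eqP.
  move: (decay a x y) (decay b z w) (decays a _ v) (decays a _ u).
  move: (decays b _ v) (decays b _ u).
  by move=> *; ring.
apply: (@le_trans _ _ (\sum_(v <- t) ka * kb * (c' * 9) * decay a x y * decay b z w *
    (decays a [:: x; y] v * decays b [:: z; w] v))).
  apply: ler_sum => v _.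
  apply: (le_trans (ler_wpM2l _ (inner v))).
    by rewrite !mulr_ge0 ?(ltW ka0) ?(ltW kb0) ?decay_ge0 ?decays_ge0.
  rewrite le_eqVlt; apply/orP; left; apply/eqP => /=.
  move: (decay a x y) (decay b z w) (decays a _ v) (decays b _ v).
  by move=> *; ring.
rewrite -mulr_sumr.
apply: le_trans (ler_wpM2l _ (conv [:: x; y] [:: z; w] t ut)) _.
  by rewrite !mulr_ge0 ?(ltW ka0) ?(ltW kb0) ?(ltW c'0) ?decay_ge0.
have tree u v : u \in [:: x; y] -> v \in [:: z; w] ->
    decay a x y * decay b z w * decay g u v <= spread_decay g x z y w.
  move=> uu.
  have H v1 v2 : decay a x y * decay b v1 v2 * decay g u v1 <= spread_decay g x y v1 v2.
    apply: le_trans (@tree_decay_le g x y v1 v2 u v1 g0 uu _); last first.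
      by rewrite !inE eqxx !orbT.
    by rewrite mulrAC !ler_pM ?mulr_ge0 ?decay_ge0 ?decay_exponent_le.
  rewrite !inE => /orP[] /eqP ->.
    rewrite (@spread_decay_eq _ x z y w x y z w); first exact: H.
    by move=> p; rewrite !inE; do 4 case: (_ == _).
  rewrite (decayC b) (@spread_decay_eq _ x z y w x y w z); first exact: H.
  by move=> p; rewrite !inE; do 4 case: (_ == _).
rewrite [leLHS](_ : _ = ka * kb * (c' * 9) * c * \sum_(u <- [:: x; y])
  \sum_(v <- [:: z; w]) decay a x y * decay b z w * decay g u v); last first.
  by under [in RHS]eq_bigr do rewrite -mulr_sumr; rewrite -mulr_sumr; ring.
rewrite -[leRHS]mulrA ler_wpM2l ?mulr_ge0 ?(ltW c0) ?(ltW c'0) ?(ltW ka0) ?(ltW kb0) //.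
have := tree x w; have := tree y z; have := tree y w.
rewrite !(big_cons, big_nil) !inE !eqxx !orbT !addr0.
have := tree x z; rewrite !inE !eqxx.
move=> /(_ isT isT) h1 /(_ isT isT) h2 /(_ isT isT) h3 /(_ isT isT) h4; lra.
Qed.

(** Expanding the product gives four sums; the two mixed ones are exchanged by
    reversing both relations. *)
Lemma pair_sum_le a b : 0 <= a < d%:R -> 0 <= b < d%:R ->
  d%:R < a + b -> exists2 C : R, 0 < C &
  forall x y z w s t, uniq s -> uniq t ->
    \sum_(u <- s) \sum_(v <- t)
      (decay a x u * decay a y v + spread_decay a x u y v) *
      (decay b u z * decay b v w + spread_decay b u z v w)
    <= C * (decay (a + b - d%:R) x z * decay (a + b - d%:R) y w +
            spread_decay (a + b - d%:R) x z y w).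
Proof.
move=> ad bd abd; set g := a + b - d%:R.
have bad : d%:R < b + a by rewrite addrC.
have [c1 c10 conv] := convolution_le ad bd abd.
have [c2 c20 ds] := sum_decay_spread_le ad bd abd.
have [c3 c30 sd] := sum_decay_spread_le bd ad bad.
have [c4 c40 ss] := sum_spread_spread_le ad bd abd.
have gE : b + a - d%:R = g by rewrite (addrC b).
exists (c1 * c1 + c2 + c3 + c4) => [|x y z w s t us ut].
  by rewrite !addr_gt0 ?mulr_gt0.
have S0 := spread_decay_gt0 g x z y w.
have K0 : 0 <= decay g x z * decay g y w by rewrite mulr_ge0 ?decay_ge0.
rewrite [leLHS](_ : _ =
  (\sum_(u <- s) decay a x u * decay b u z) *
    (\sum_(v <- t) decay a y v * decay b v w) +
  \sum_(u <- s) \sum_(v <- t) decay a x u * decay a y v * spread_decay b u z v w +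
  \sum_(u <- s) \sum_(v <- t) decay b z u * decay b w v * spread_decay a u x v y +
  \sum_(u <- s) \sum_(v <- t) spread_decay a x u y v * spread_decay b u z v w); last first.
  rewrite mulr_suml -!big_split; apply: eq_bigr => u _ /=.
  rewrite mulr_sumr -!big_split; apply: eq_bigr => v _ /=.
  rewrite (decayC b z) (decayC b w) (@spread_decay_eq a u x v y x u y v); first by ring.
  by move=> p; rewrite !inE; do 4 case: (_ == _).
have h1 : (\sum_(u <- s) decay a x u * decay b u z) *
    (\sum_(v <- t) decay a y v * decay b v w)
    <= c1 * c1 * (decay g x z * decay g y w).
  rewrite mulrACA ler_pM //; try exact: conv;
    by apply: sumr_ge0 => ? _; rewrite mulr_ge0 ?decay_ge0.
have h2 := ds x y z w s t us ut.
have h3 := sd z w x y s t us ut; rewrite gE in h3.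
rewrite (@spread_decay_eq g z x w y x z y w) in h3; last first.
  by move=> p; rewrite !inE; do 4 case: (_ == _).
have h4 := ss x y z w s t us ut.
have : 0 <= (c2 + c3 + c4) * (decay g x z * decay g y w).
  by rewrite mulr_ge0 ?addr_ge0 // ltW.
have : 0 <= c1 * c1 * spread_decay g x z y w by rewrite !mulr_ge0 // ltW.
rewrite -/g in h2 h4 *; rewrite !mulrDl !mulrDr; lra.
Qed.

End PairSums.

(** * Divergence of the sums of power laws of exponent at most the dimension *)

Section BoxSums.
Variables (R : realType) (d : nat).
Implicit Types (a b : R) (u v x y z h : Zd d) (s t : seq (Zd d)) (n m : nat).

Lemma box_translate x n : box x n = [seq x + h | h <- box (0 : Zd d) n].
Proof. by rewrite /box -map_comp; apply: eq_map => k /=; rewrite add0r. Qed.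

Lemma decay_translate a x u v : decay a (x + u) (x + v) = decay a u v.
Proof.
rewrite decay.unlock /bracket; congr ((1 + _)%N%:R `^ _); apply: eq_bigr => i _.
by rewrite !mxE opprD addrACA subrr add0r.
Qed.

Lemma sum_box_decay a x n :
  \sum_(y <- box x n) decay a x y = \sum_(y <- box (0 : Zd d) n) decay a 0 y.
Proof.
rewrite box_translate big_map; apply: eq_bigr => h _.
by rewrite -{1}[x]addr0 decay_translate.
Qed.

(** Each point of the large box is [3 h + r] with [h] in the small box and [r] in
    the unit box, which has [3 ^ d] points; and [3 h + r] is at least as far from
    [0] as [h]. *)
Lemma sum_box_triple_le a n : 0 <= a ->
  \sum_(y <- box (0 : Zd d) (3 * n)) decay a 0 y <=
  3 ^+ d * \sum_(y <- box (0 : Zd d) n) decay a 0 y.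
Proof.
move=> a0.
pose t := [seq h *+ 3 + r | h <- box (0 : Zd d) n, r <- box (0 : Zd d) 1].
apply: (@le_trans _ _ (\sum_(y <- t) decay a 0 y)).
  apply: sum_le_incl (box_uniq _ _) _ => [y|y]; first exact: decay_ge0.
  rewrite mem_box => /forallP yn.
  (* [h] is [y / 3], rounded to the nearest integer in each coordinate. *)
  pose h : Zd d := \row_i (sgz (y ord0 i) * ((absz (y ord0 i)).+1 %/ 3)%N%:Z).
  apply/allpairsP; exists (h, y - h *+ 3); split=> /=.
  - rewrite mem_box; apply/forallP => i; rewrite !mxE; move: (yn i); rewrite !mxE.
    by move: (y ord0 i) => c; case: (sgzP c); lia.
  - rewrite mem_box; apply/forallP => i; rewrite !mxE.
    by move: (y ord0 i) => c; case: (sgzP c); lia.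
  - by rewrite addrC subrK.
rewrite big_allpairs_dep mulr_sumr; apply: ler_sum => h _.
apply: (@le_trans _ _ (\sum_(r <- box (0 : Zd d) 1) decay a 0 h)); last first.
  rewrite big_const_seq count_predT iter_addr_0 size_box.
  by rewrite -[leLHS]mulr_natl natrX.
rewrite big_seq [leRHS]big_seq; apply: ler_sum => r; rewrite mem_box => /forallP r1.
apply: decay_le => //; rewrite leq_add2l; apply: leq_sum => i _.
by move: (r1 i); rewrite !mxE; move: (h ord0 i) (r ord0 i); lia.
Qed.

(** The large box has at least [n ^ d] points outside the small one, each
    contributing at least [(4 d n) ^ (- d)]: tripling the box always adds a fixed
    amount, whence divergence. *)
Lemma sum_box_triple_ge a n : (0 < d)%N -> (0 < n)%N -> 0 <= a <= d%:R ->
  \sum_(y <- box (0 : Zd d) n) decay a 0 y + (4 * d)%:R ^- d <=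
  \sum_(y <- box (0 : Zd d) (3 * n)) decay a 0 y.
Proof.
move=> d0 n0 /andP[a0 ad].
set B := box (0 : Zd d) (3 * n); set A := box (0 : Zd d) n.
have AB : {subset A <= B}.
  move=> y; rewrite !mem_box => /forallP H; apply/forallP => i.
  by apply: leq_trans (H i) _; lia.
rewrite [leRHS](bigID (mem A)) /=; apply: lerD.
  rewrite -[leRHS]big_filter; apply: sum_le_incl (box_uniq _ _) _ => [y|y yA].
    exact: decay_ge0.
  by rewrite mem_filter yA AB.
rewrite -[leRHS]big_filter; set t := [seq _ <- _ | _].
have st : (n ^ d <= size t)%N.
  have -> : size t = (size B - size A)%N.
    rewrite -(count_predC (mem A) B) size_filter.
    suff -> : count (mem A) B = size A by rewrite addnC addnK.
    rewrite -size_filter; apply: perm_size; apply: uniq_perm.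
    - by rewrite filter_uniq ?box_uniq.
    - exact: box_uniq.
    - move=> y; rewrite mem_filter; apply/andP/idP => [[]//|yA].
      by split=> //; exact: AB.
  rewrite !size_box.
  apply: (@leq_trans ((2 * n.*2.+1) ^ d - n.*2.+1 ^ d)).
    rewrite expnMn; apply: (@leq_trans (n.*2.+1 ^ d)).
      by rewrite leq_exp2r //; lia.
    have : (2 <= 2 ^ d)%N by rewrite -{1}(expn1 2) leq_exp2l.
    by move: (2 ^ d)%N (n.*2.+1 ^ d)%N; nia.
  by apply: leq_sub2r; rewrite leq_exp2r //; lia.
apply: (@le_trans _ _ (\sum_(y <- t) (4 * d * n)%:R ^- d)).
  rewrite big_const_seq count_predT iter_addr_0 -[leRHS]mulr_natl.
  apply: (@le_trans _ _ ((n ^ d)%:R * (4 * d * n)%:R ^- d)).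
    rewrite [in leRHS]natrM exprMn invfM mulrCA natrX mulfV ?mulr1 //.
    by rewrite expf_neq0 // pnatr_eq0 -lt0n.
  by rewrite ler_wpM2r ?ler_nat // invr_ge0 exprn_ge0.
rewrite big_seq [leRHS]big_seq; apply: ler_sum => y.
rewrite mem_filter => /andP[_ /box_sub_bracket yB].
apply: (@le_trans _ _ (decay d%:R 0 y)); last exact: decay_exponent_le.
rewrite -powR_invn ?ler0n // decay.unlock; apply: powRN_antitone => //.
by apply: leq_trans yB _; nia.
Qed.

Lemma sum_box_unbounded a (M : R) (m : nat) : (0 < d)%N -> 0 <= a <= d%:R ->
  exists2 n : nat, (m <= n)%N & M <= \sum_(y <- box (0 : Zd d) n) decay a 0 y.
Proof.
move=> d0 ad; set e : R := (4 * d)%:R ^- d.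
have e0 : 0 < e by rewrite invr_gt0 exprn_gt0 // ltr0n muln_gt0.
have step k : k%:R * e <= \sum_(y <- box (0 : Zd d) (3 ^ k)) decay a 0 y.
  elim: k => [|k IH]; first by rewrite mul0r sumr_ge0 // => y _; exact: decay_ge0.
  rewrite expnS; apply: le_trans (sum_box_triple_ge d0 _ ad); rewrite ?expn_gt0 //.
  by rewrite -natr1 mulrDl mul1r lerD2r.
have [k kM] : exists k : nat, M / e <= k%:R.
  by exists (Num.truncn (M / e)).+1; apply: ltW; exact: truncnS_gt.
exists (3 ^ (k + m))%N.
  by apply: leq_trans (leq_addl k m) _; apply: ltnW; exact: ltn_expl.
apply: le_trans (step (k + m)%N); rewrite -ler_pdivrMr //.
by apply: le_trans kM _; rewrite ler_nat leq_addr.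
Qed.

End BoxSums.

(** * Boxes of intermediate points with a controlled second moment *)

Section SecondMomentBox.
Variables (R : realType) (d : nat).
Implicit Types (a b : R) (u v x y z h p q : Zd d) (s t U V : seq (Zd d)) (n m : nat).

(** The box of radius [m = bracket x z] around [x] has at least [m ^ d] points, and
    for each of them both distances are of order [m], so that the sum is at least
    of order [m ^ (d - a - b)]; the second moment is bounded by the convolution
    estimate. *)
Lemma second_moment_box_gt a b : 0 <= a < d%:R -> 0 <= b < d%:R -> d%:R < a + b ->
  exists2 c : R, 0 < c & forall x z, exists (s : seq (Zd d)) (k : R), [/\ uniq s, 0 < k,
    forall u, u \in s -> \sum_(y <- s) decays a [:: x; u] y * decays b [:: z; u] y <= k &
    c * decay (a + b - d%:R) x z * k <= \sum_(y <- s) decay a x y * decay b y z].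
Proof.
move=> ad bd abd; set g := a + b - d%:R.
have [/andP[a0 _] /andP[b0 _]] := (ad, bd).
have g0 : 0 <= g by rewrite subr_ge0 ltW.
have [C C0 conv] := convolution_le ad bd abd.
pose e : R := (2 + d)%:R `^ a * (2 + d)%:R `^ b.
have e0 : 0 < e by rewrite mulr_gt0 ?powR_gt0 ?ltr0n.
exists (e * (4 * C))^-1; first by rewrite invr_gt0 !mulr_gt0.
move=> x z; set m := bracket x z; exists (box x m), (4 * C); split.
- exact: box_uniq.
- by rewrite mulr_gt0.
- move=> u _; have := @sum_decays_le R d a b [:: x; u] [:: z; u] (box x m) C.
  apply=> p q _ _.
  apply: le_trans (conv p q _ (box_uniq _ _)) _.
  by rewrite -[leRHS]mulr1 ler_pM2l // decay_le1.
rewrite mulrAC invfM mulfVK ?gt_eqF ?mulr_gt0 // ler_pdivrMl //.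
have pt y : y \in box x m -> decay (a + b) x z <= e * (decay a x y * decay b y z).
  move=> /box_sub_bracket yb; rewrite -decayD /e mulrACA.
  have tri := bracket_triangle y z x; rewrite (bracketC y x) -/m in tri.
  have m0 : (0 < m)%N by [].
  by apply: ler_pM; rewrite ?decay_ge0 //; apply: decay_comparison => //;
    rewrite -/m; move: (bracket x y) (bracket y z) m m0 yb tri; clear; nia.
rewrite mulr_sumr [leRHS]big_seq.
apply: le_trans (ler_sum _ pt); rewrite -big_seq big_const_seq count_predT iter_addr_0.
rewrite size_box -mulr_natl.
have -> : decay g x z = (m ^ d)%:R * decay (a + b) x z.
  rewrite natrX -powR_mulrn // decay.unlock -powRD ?pnatr_eq0 ?implybT //.
  by rewrite /g opprB.
rewrite ler_wpM2r ?decay_ge0 // ler_nat.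
by case: (d) => // d'; rewrite leq_exp2r //; lia.
Qed.

(** A large box of radius [n] around [x] is used.  Far from [x] and [z] the product
    of the two kernels is comparable to [decay (a + b) x y], whose sum over the
    box diverges with [n]; so for large [n] the points near [x], where this fails,
    carry at most half of the sum.  For the second moment, the product of the
    kernels at [p] and [q] is at most the sum of the powers of exponent [a + b] at
    [p] and at [q]; summed over a box of radius [n], each of these is, by
    tripling, of the order of the sum centred at [0]. *)
Lemma second_moment_box_le a b : 0 <= a < d%:R -> 0 <= b < d%:R -> a + b <= d%:R ->
  exists2 c : R, 0 < c & forall x z, exists (s : seq (Zd d)) (k : R), [/\ uniq s, 0 < k,
    forall u, u \in s -> \sum_(y <- s) decays a [:: x; u] y * decays b [:: z; u] y <= k &
    c * k <= \sum_(y <- s) decay a x y * decay b y z].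
Proof.
move=> ad bd abd.
have [/andP[a0 a1] /andP[b0 _]] := (ad, bd).
have d0 : (0 < d)%N by rewrite -(ltr0n R); apply: le_lt_trans a1.
have ab0 : 0 <= a + b by rewrite addr_ge0.
pose G n := \sum_(y <- box (0 : Zd d) n) decay (a + b) 0 y.
pose e : R := 2%:R `^ b; have e0 : 0 < e by rewrite powR_gt0 ?ltr0n.
pose f : R := 3 ^+ d; have f0 : 0 < f by rewrite exprn_gt0.
exists (2 * e * (4 * (2 * f)))^-1; first by rewrite invr_gt0 !mulr_gt0.
move=> x z; set m := bracket x z.
have Gge n : 0 <= G n by apply: sumr_ge0 => y _; exact: decay_ge0.
have [|n mn Gn] := @sum_box_unbounded R d (a + b) (2 * G m + 1) m d0; first by rewrite ab0.
rewrite -/(G n) in Gn.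
have Gn0 : 0 < G n by apply: lt_le_trans Gn; rewrite ltr_wpDl // mulr_ge0.
exists (box x n), (4 * (2 * (f * G n))); split.
- exact: box_uniq.
- by rewrite !mulr_gt0.
- have one p : p \in box x n -> \sum_(y <- box x n) decay (a + b) p y <= f * G n.
    rewrite mem_box => /forallP pn.
    apply: (le_trans _ (@sum_box_triple_le R d (a + b) n ab0)).
    rewrite -(sum_box_decay _ p).
    apply: sum_le_incl (box_uniq _ _) _ => [y|y]; first exact: decay_ge0.
    rewrite !mem_box => /forallP yn; apply/forallP => i; move: (pn i) (yn i).
    by move: (x ord0 i) (p ord0 i) (y ord0 i); clear; lia.
  have two p q : p \in box x n -> q \in box x n ->
      \sum_(y <- box x n) decay a p y * decay b y q <= 2 * (f * G n).
    move=> pn qn.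
    apply: (@le_trans _ _ (\sum_(y <- box x n) (decay (a + b) p y + decay (a + b) q y))).
      apply: ler_sum => y _; rewrite (decayC b).
      have [le|/ltnW le] := leqP (bracket p y) (bracket q y).
        rewrite -[leLHS]addr0 lerD ?decay_ge0 // -decayD ler_wpM2l ?decay_ge0 //.
        exact: decay_le.
      rewrite -[leLHS]add0r lerD ?decay_ge0 // -decayD ler_wpM2r ?decay_ge0 //.
      exact: decay_le.
    by rewrite big_split /= mulr_natl mulr2n lerD ?one.
  move=> u un; have := @sum_decays_le R d a b [:: x; u] [:: z; u] (box x n) (2 * (f * G n)).
  apply=> p q; rewrite !inE => pU qV; apply: two.
    case/orP: pU => /eqP -> //; rewrite mem_box; apply/forallP => i.
    by rewrite subrr.
  case/orP: qV => /eqP -> //; apply: bracket_sub_box.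
  by rewrite -/m; apply: leqW.
have le1 : G n <= G m + e * \sum_(y <- box x n) decay a x y * decay b y z.
  rewrite /G -!(sum_box_decay _ x) mulr_sumr.
  apply: (@le_trans _ _ (\sum_(y <- box x n)
    ((if y \in box x m then decay (a + b) x y else 0) +
     e * (decay a x y * decay b y z)))).
    apply: ler_sum => y _; case: ifPn => ym.
      by rewrite lerDl !mulr_ge0 ?decay_ge0 // ltW.
    rewrite add0r -decayD mulrCA ler_wpM2l ?decay_ge0 //.
    apply: decay_comparison => //.
    have : (m <= bracket x y)%N.
      rewrite leqNgt; apply: contra ym => lt; apply: bracket_sub_box.
      exact/ltnW/ltnW.
    have := bracket_triangle y z x; rewrite (bracketC y x) -/m.
    by move: (bracket x y) (bracket y z) (m); clear; lia.
  rewrite big_split lerD2r -big_mkcond -big_filter.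
  apply: sum_le_incl; rewrite ?filter_uniq ?box_uniq // => y; first exact: decay_ge0.
  by rewrite mem_filter => /andP[].
rewrite ler_pdivrMl ?mulr_gt0 //.
move: le1; set M := \sum_(y <- _) _; move=> le1.
have {}le1 : G n <= 2 * (e * M) by lra.
rewrite [leRHS](_ : _ = 4 * (2 * (f * (2 * (e * M))))); last by ring.
by do 3 (rewrite ler_pM2l //).
Qed.

End SecondMomentBox.

(** * Two inequalities for events *)

Section Events.
Variables (disp : measure_display) (T : measurableType disp) (R : realType)
  (P : probability T R).
Local Open Scope ereal_scope.

Lemma integral_sum_indic (I : Type) (s : seq I) (A : I -> set T) (c : R) :
  (0 <= c)%R -> (forall i, measurable (A i)) ->
  \int[P]_x (c * \sum_(i <- s) \1_(A i) x)%:E = c%:E * \sum_(i <- s) P (A i).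
Proof.
move=> c0 mA.
under eq_integral do rewrite EFinM -sumEFin.
rewrite ge0_integralZl_EFin //; last first.
- by apply: emeasurable_sum => i; exact/measurable_EFinP/measurable_indic.
- by move=> x _; apply: sume_ge0 => i _; rewrite lee_fin indicE ler0n.
congr (_ * _); rewrite ge0_integral_sum //.
  by apply: eq_bigr => i _; rewrite integral_indic // setIT.
by move=> i; exact/measurable_EFinP/measurable_indic.
Qed.

(** With [N] the number of the events that occur and [l = m / B], the pointwise
    inequality [2 l N <= 1_U + l ^ 2 N ^ 2] holds: it is [(l N - 1) ^ 2 >= 0] on
    [U], and [N] vanishes outside [U].  Integrating it gives the bound. *)
Lemma chung_erdos (I : eqType) (s : seq I) (A : I -> set T) (U : set T) (m B : R) :
  (forall i, measurable (A i)) -> measurable U -> (forall i, A i `<=` U) ->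
  (0 < B)%R -> (0 <= m)%R ->
  m%:E <= \sum_(i <- s) P (A i) ->
  \sum_(i <- s) \sum_(j <- s) P (A i `&` A j) <= B%:E ->
  (m ^+ 2 / B)%:E <= P U.
Proof.
move=> mA mU AU B0 m0 mle leB; set l : R := (m / B)%R.
have l0 : (0 <= l)%R by rewrite divr_ge0 // ltW.
pose AA (ij : I * I) := A ij.1 `&` A ij.2.
have mAA ij : measurable (AA ij) by exact: measurableI.
pose ss := [seq (i, j) | i <- s, j <- s].
have pt x : ((l *+ 2) * \sum_(i <- s) \1_(A i) x <=
    \1_U x + l ^+ 2 * \sum_(ij <- ss) \1_(AA ij) x)%R.
  have -> : (\sum_(ij <- ss) \1_(AA ij) x = (\sum_(i <- s) \1_(A i) x) ^+ 2 :> R)%R.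
    rewrite big_allpairs_dep expr2 mulr_suml; apply: eq_bigr => i _.
    by rewrite mulr_sumr; apply: eq_bigr => j _; rewrite /AA /= indicI.
  have [xU|xU] := pselect (U x).
    rewrite (_ : \1_U x = 1)%R; last by rewrite indicE mem_set.
    set N := (\sum_(i <- s) _)%R; have := sqr_ge0 (l * N - 1)%R.
    rewrite sqrrB1 exprMn; lra.
  rewrite (_ : \sum_(i <- s) _ = 0)%R.
    by rewrite mulr0 expr0n mulr0 addr0 indicE ler0n.
  by rewrite big1 // => i _; rewrite indicE memNset // => /AU.
have : \int[P]_x ((l *+ 2) * \sum_(i <- s) \1_(A i) x)%:E <=
       \int[P]_x (\1_U x + l ^+ 2 * \sum_(ij <- ss) \1_(AA ij) x)%:E.
  apply: ge0_le_integral => //.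
  - by move=> x _; rewrite lee_fin mulr_ge0 ?mulrn_wge0 // sumr_ge0.
  - apply/measurable_EFinP/measurable_funM => //.
    by apply: measurable_sum => i; exact: measurable_indic.
  - apply/measurable_EFinP/measurable_funD; first exact: measurable_indic.
    apply/measurable_funM => //.
    by apply: measurable_sum => i; exact: measurable_indic.
  - by move=> x _; rewrite lee_fin.
rewrite integral_sum_indic ?mulrn_wge0 //.
under [X in _ <= X]eq_integral do rewrite EFinD.
rewrite ge0_integralD //; last 3 first.
- by apply/measurable_EFinP; exact: measurable_indic.
- by move=> x _; rewrite lee_fin mulr_ge0 ?sqr_ge0 ?sumr_ge0.
- apply/measurable_EFinP/measurable_funM => //.
  by apply: measurable_sum => i; exact: measurable_indic.
rewrite integral_indic // setIT integral_sum_indic ?sqr_ge0 //.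
rewrite big_allpairs_dep /= => main.
have lhs : ((l *+ 2) * m)%:E <= (l *+ 2)%:E * \sum_(i <- s) P (A i).
  by rewrite EFinM lee_wpmul2l // lee_fin mulrn_wge0.
have rhs : P U + (l ^+ 2)%:E * (\sum_(i <- s) \sum_(j <- s) P (AA (i, j))) <=
   P U + (l ^+ 2 * B)%:E.
  by rewrite (EFinM (l ^+ 2)); apply/leeD2l/lee_wpmul2l; rewrite // lee_fin sqr_ge0.
have := le_trans lhs (le_trans main rhs).
rewrite -(fineK (fin_num_measure P U mU)) -EFinD !lee_fin.
have -> : (m ^+ 2 / B = l *+ 2 * m - l ^+ 2 * B)%R by rewrite /l; field; rewrite gt_eqF.
lra.
Qed.

Lemma countable_union_le (I : countType) (A : I -> set T) (U : set T) (B : \bar R) :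
  (forall i, measurable (A i)) -> measurable U -> U `<=` \bigcup_i A i ->
  (forall s : seq I, uniq s -> \sum_(i <- s) P (A i) <= B) -> P U <= B.
Proof.
move=> mA mU UA le; pose F (n : nat) := if pickle_inv n is Some i then A i else set0.
have mF n : measurable (F n) by rewrite /F; case: pickle_inv.
have UF : U `<=` \bigcup_n F n.
  by move=> x /UA [i _ xi]; exists (choice.pickle i) => //; rewrite /F pickleK_inv.
apply: le_trans (measure_sigma_subadditive P mF mU UF) _.
apply: lime_le; first exact: is_cvg_nneseries.
apply: nearW => n.
have us := pmap_uniq (@pickle_invK I) (iota_uniq 0 n).
apply: le_trans (le _ us); rewrite /index_iota subn0.
elim: (iota 0 n) => [|k l IH]; first by rewrite !big_nil.
rewrite big_cons /= {1}/F; case: pickle_inv => [i|] /=.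
  by rewrite big_cons leeD2l.
by rewrite measure0 add0e.
Qed.

End Events.

(** * Composition of independent relations *)

Section PairDecay.
Variables (R : realType) (d : nat).
Implicit Types (a b : R) (x y z : Zd d).

(** The bound on the joint law of two pairs with a common endpoint [x]: attaching
    [z] to the nearer of [x] and [y] dominates both terms. *)
Lemma fork_decay_le a : 0 <= a -> exists2 C : R, 0 < C & forall x y z,
  decay a x y * decay a x z + spread_decay a x y x z <=
  C * (decay a x y * decays a [:: x; y] z).
Proof.
move=> a0; have [k k0 le] := @spread_decay_le R d a a0.
exists (1 + k * 4) => [|x y z]; first by rewrite addr_gt0 ?mulr_gt0.
rewrite mulrDl mul1r lerD //.
  by rewrite ler_wpM2l ?decay_ge0 // decay_le_decays ?mem_head.
apply: le_trans (le x y x z) _; rewrite -[leRHS]mulrA ler_pM2l //.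
rewrite -[leLHS]mulrA [leRHS]mulrCA ler_wpM2l ?decay_ge0 //.
rewrite decays.unlock !(big_cons, big_nil) !addr0 decayxx.
have := decay_le1 y x a0; have := decay_ge0 a x z; have := decay_ge0 a y z.
by have := decay_ge0 a y x; nra.
Qed.

Lemma second_moment_box a b : 0 <= a < d%:R -> 0 <= b < d%:R ->
  exists2 c : R, 0 < c & forall x z, exists (s : seq (Zd d)) (k : R), [/\ uniq s, 0 < k,
    forall u, u \in s -> \sum_(y <- s) decays a [:: x; u] y * decays b [:: z; u] y <= k &
    c * decay (Num.max (a + b - d%:R) 0) x z * k <=
      \sum_(y <- s) decay a x y * decay b y z].
Proof.
move=> ad bd; have [abd|abd] := ltP (d%:R : R) (a + b).
  have -> : Num.max (a + b - d%:R) 0 = a + b - d%:R.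
    by apply/max_idPl; rewrite subr_ge0 ltW.
  exact: second_moment_box_gt.
have -> : Num.max (a + b - d%:R) 0 = 0 by apply/max_idPr; rewrite subr_le0.
have [c c0 H] := second_moment_box_le ad bd abd; exists c => // x z.
have [s [k [us k0 Hk Hc]]] := H x z; exists s, k; split => //.
by rewrite decay0 mulr1.
Qed.

End PairDecay.

Section Composition.
Variables (disp : measure_display) (T : measurableType disp) (R : realType)
  (P : probability T R) (d : nat).
Implicit Types (L Q : T -> set (Zd d * Zd d)) (x y z w u v : Zd d) (a b g : R).
Local Open Scope ereal_scope.

Lemma composition_event L Q x z :
  rel_event (composition L Q) x z =
  \bigcup_y (rel_event L x y `&` rel_event Q y z).
Proof. by apply/seteqP; split => [r [y [Lr Qr]] | r [y _ [Lr Qr]]]; exists y. Qed.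

Lemma measurable_composition L Q : random_relation L -> random_relation Q ->
  random_relation (composition L Q).
Proof.
move=> mL mQ x z; rewrite composition_event; apply: countable_bigcupT_measurable => //.
by move=> y; apply: measurableI; [exact: mL|exact: mQ].
Qed.

Definition dimension_bounds L a (C : R) :=
  (forall x z, (decay a x z)%:E <= C%:E * P (rel_event L x z)) /\
  (forall x y z w, P (rel_event L x z `&` rel_event L y w) <=
    (C * (decay a x z * decay a y w + spread_decay a x z y w))%:E).

(** A constant in the lower bound is automatically positive, because the left-hand
    side is [1] on the diagonal. *)
Lemma dimension_boundsP L (s : R) : stochastic_dimension P L s ->
  exists a, [/\ (0 <= a < d%:R)%R, s = (d%:R - a)%R &
    exists2 C : R, (0 < C)%R & dimension_bounds L a C].
Proof.
case=> a [ad sE [C H]]; exists a; split=> //; exists C.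
  have [+ _] := H 0%R 0%R 0%R 0%R; rewrite ltNge; apply: contraTN => C0.
  rewrite -ltNge; apply: (@le_lt_trans _ _ 0).
    by apply: mule_le0_ge0; rewrite ?lee_fin.
  by rewrite lte_fin powR_gt0.
split=> [x z|x y z w].
  by have [] := H x 0%R z 0%R; rewrite decay.unlock.
have [_] := H x y z w; rewrite decay.unlock spread_decay.unlock => /le_trans; apply.
by rewrite lee_fin mulrDr mulrA.
Qed.

Lemma dimension_boundsW L a (C1 C2 : R) : (0 <= a < d%:R)%R ->
  (forall x z, (decay a x z)%:E <= C1%:E * P (rel_event L x z)) ->
  (forall x y z w, P (rel_event L x z `&` rel_event L y w) <=
    (C2 * (decay a x z * decay a y w + spread_decay a x z y w))%:E) ->
  stochastic_dimension P L (d%:R - a)%R.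
Proof.
move=> ad lo up; exists a; split => //; exists (Num.max C1 C2) => x y z w; split.
  have := lo x z; rewrite decay.unlock => /le_trans; apply.
  by apply: lee_wpmul2r; rewrite ?measure_ge0 // lee_fin le_max lexx.
apply: (le_trans (up x y z w)); rewrite decay.unlock spread_decay.unlock lee_fin.
by rewrite -(mulrA (Num.max _ _)) -mulrDr ler_wpM2r ?le_max ?lexx ?orbT.
Qed.

Lemma relation_sigma_event L x z : relation_sigma L (rel_event L x z).
Proof. by apply: sub_sigma_algebra; exists x, z. Qed.

Lemma relation_sigmaI L A B : relation_sigma L A -> relation_sigma L B ->
  relation_sigma L (A `&` B).
Proof.
exact: (@measurableI _
  (g_sigma_algebraType [set A | exists x z, A = rel_event L x z]) A B).
Qed.

Lemma independent_events L Q x y z w u v u' v' : independent_relations P L Q ->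
  P ((rel_event L x u `&` rel_event Q u' z) `&` (rel_event L y v `&` rel_event Q v' w)) =
  P (rel_event L x u `&` rel_event L y v) * P (rel_event Q u' z `&` rel_event Q v' w).
Proof.
move=> ind; rewrite setIACA; apply: ind; apply: relation_sigmaI;
  exact: relation_sigma_event.
Qed.

(** Union bound over the pairs [(u, v)] of intermediate points of [(x, z)] and
    [(y, w)]; independence turns each term into a product of two joint laws. *)
Lemma composition_upper L Q a b (CL CQ : R) :
  random_relation L -> random_relation Q -> independent_relations P L Q ->
  (0 <= a < d%:R)%R -> (0 <= b < d%:R)%R -> (d%:R < a + b)%R ->
  (0 < CL)%R -> (0 < CQ)%R -> dimension_bounds L a CL -> dimension_bounds Q b CQ ->
  exists C : R, forall x y z w,
    P (rel_event (composition L Q) x z `&` rel_event (composition L Q) y w) <=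
    (C * (decay (a + b - d%:R) x z * decay (a + b - d%:R) y w +
          spread_decay (a + b - d%:R) x z y w))%:E.
Proof.
move=> mL mQ ind ad bd abd CL0 CQ0 [_ upL] [_ upQ].
have [C C0 sums] := pair_sum_le ad bd abd; exists (CL * CQ * C)%R => x y z w.
pose A (uv : Zd d * Zd d) := (rel_event L x uv.1 `&` rel_event Q uv.1 z) `&`
  (rel_event L y uv.2 `&` rel_event Q uv.2 w).
pose f u v : R := (CL * CQ * ((decay a x u * decay a y v + spread_decay a x u y v) *
      (decay b u z * decay b v w + spread_decay b u z v w)))%R.
have PA uv : P (A uv) <= (f uv.1 uv.2)%:E.
  rewrite /A independent_events // /f mulrACA EFinM.
  by apply: lee_pmul; rewrite ?measure_ge0.
have f0 u v : (0 <= f u v)%R.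
  by rewrite !mulr_ge0 ?addr_ge0 ?mulr_ge0 ?decay_ge0 // ltW ?spread_decay_gt0.
have mA uv : measurable (A uv).
  by apply: measurableI; apply: measurableI; [exact: mL|exact: mQ|exact: mL|exact: mQ].
apply: (@countable_union_le _ T R P _ A _ _ mA).
- by apply: measurableI; exact: measurable_composition.
- rewrite !composition_event => r [[u _ ru] [v _ rv]].
  by exists (u, v).
move=> s us; apply: (@le_trans _ _ (\sum_(uv <- s) (f uv.1 uv.2)%:E)).
  exact: lee_sum.
rewrite sumEFin lee_fin.
pose t1 := undup (map fst s); pose t2 := undup (map snd s).
apply: (@le_trans _ _ (\sum_(u <- t1) \sum_(v <- t2) f u v)%R).
  have -> : (\sum_(u <- t1) \sum_(v <- t2) f u v =
      \sum_(uv <- [seq (u, v) | u <- t1, v <- t2]) f uv.1 uv.2)%R.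
    by rewrite big_allpairs_dep.
  apply: sum_le_incl us _ => // -[u v] uvs; apply/allpairsP; exists (u, v).
  by rewrite !mem_undup; split => //; apply/mapP; exists (u, v).
rewrite /f; under eq_bigr do rewrite -mulr_sumr; rewrite -mulr_sumr -[leRHS]mulrA.
rewrite ler_pM2l ?mulr_gt0 //; apply: sums; exact: undup_uniq.
Qed.

(** Second moment method for the number of intermediate points in the box [s].
    The first moment is at least [K^-1 M]; the second is at most
    [K Da Db (M k)], since for each [y] the joint law summed over the other
    intermediate point is at most [k] times the law of [y].  As [M] is at least
    [c k decay g x z], the quotient [M / k] is of the required order. *)
Lemma composition_lower L Q a b (CL CQ : R) :
  random_relation L -> random_relation Q -> independent_relations P L Q ->
  (0 <= a < d%:R)%R -> (0 <= b < d%:R)%R ->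
  (0 < CL)%R -> (0 < CQ)%R -> dimension_bounds L a CL -> dimension_bounds Q b CQ ->
  exists C : R, forall x z,
    (decay (Num.max (a + b - d%:R) 0) x z)%:E <=
    C%:E * P (rel_event (composition L Q) x z).
Proof.
move=> mL mQ ind ad bd CL0 CQ0 [loL upL] [loQ upQ].
have [/andP[a0 _] /andP[b0 _]] := (ad, bd).
set g := Num.max _ _.
have [Da Da0 forkL] := @fork_decay_le R d a a0.
have [Db Db0 forkQ] := @fork_decay_le R d b b0.
have [c c0 boxes] := @second_moment_box R d a b ad bd.
pose K : R := (CL * CQ)%R; have K0 : (0 < K)%R by rewrite mulr_gt0.
exists (K ^+ 3 * Da * Db / c)%R => x z.
have [s [k [us k0 Hk HM]]] := boxes x z; rewrite -/g in HM.
set M := (\sum_(y <- s) _)%R in HM.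
have M0 : (0 < M)%R.
  by apply: lt_le_trans HM; rewrite !mulr_gt0 ?decay_gt0.
pose A y := rel_event L x y `&` rel_event Q y z.
have mA y : measurable (A y) by apply: measurableI; [exact: mL|exact: mQ].
have first_moment y : (K^-1 * (decay a x y * decay b y z))%:E <= P (A y).
  rewrite /A ind; try exact: relation_sigma_event.
  rewrite /K invfM mulrACA EFinM.
  by apply: lee_pmul;
    rewrite ?lee_fin ?mulr_ge0 ?invr_ge0 ?decay_ge0 ?(ltW CL0) ?(ltW CQ0) //
     EFinM lee_pdivrMl.
have second_moment y y' : P (A y `&` A y') <= (K * Da * Db * (decay a x y * decay b y z *
    (decays a [:: x; y] y' * decays b [:: z; y] y')))%:E.
  rewrite /A independent_events //.
  apply: (@le_trans _ _ ((CL * (Da * (decay a x y * decays a [:: x; y] y')))%:E *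
    (CQ * (Db * (decay b y z * decays b [:: z; y] y')))%:E)).
    apply: lee_pmul; rewrite ?measure_ge0 //.
      by apply: le_trans (upL x x y y') _; rewrite lee_fin ler_pM2l.
    apply: le_trans (upQ y y' z z) _; rewrite lee_fin ler_pM2l //.
    rewrite (decayC b y z) (decayC b y' z).
    rewrite (@spread_decay_eq _ _ b y z y' z z y z y'); first exact: forkQ.
    by move=> p; rewrite !inE; do 3 case: (_ == _).
  rewrite -EFinM lee_fin /K le_eqVlt; apply/orP; left; apply/eqP.
  move: (decay a x y) (decay b y z) (decays a _ y') (decays b _ y') => *; ring.
pose B : R := (K * Da * Db * (M * k))%R.
have B0 : (0 < B)%R by rewrite !mulr_gt0.
have := @chung_erdos _ T R P _ s A (rel_event (composition L Q) x z) (K^-1 * M)%R B mA.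
move=> /(_ (measurable_composition mL mQ x z)) ce.
have {}ce : ((K^-1 * M) ^+ 2 / B)%:E <= P (rel_event (composition L Q) x z).
  apply: ce => //.
  - by move=> y; rewrite composition_event; exact: bigcup_sup.
  - by rewrite mulr_ge0 // ?invr_ge0 ltW.
  - by rewrite mulr_sumr -sumEFin; apply: lee_sum => y _; exact: first_moment.
  apply: (@le_trans _ _ (\sum_(y <- s) (K * Da * Db * (decay a x y * decay b y z * k))%:E)).
    rewrite big_seq [leRHS]big_seq; apply: lee_sum => y ys.
    apply: le_trans (lee_sum _ (fun y' _ => second_moment y y')) _.
    rewrite sumEFin lee_fin -!mulr_sumr ler_pM2l ?mulr_gt0 //.
    by rewrite ler_wpM2l ?mulr_ge0 ?decay_ge0 // Hk.
  by rewrite sumEFin lee_fin /B -mulr_sumr -mulr_suml.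
have C0 : (0 <= K ^+ 3 * Da * Db / c)%R.
  by rewrite !mulr_ge0 ?exprn_ge0 ?invr_ge0 // ltW.
apply: le_trans (lee_wpmul2l _ ce); last by rewrite lee_fin.
rewrite -EFinM lee_fin.
rewrite [leRHS](_ : _ = M / (c * k))%R; last first.
  by rewrite /B; field; rewrite !gt_eqF.
by rewrite ler_pdivlMr ?mulr_gt0 // mulrC mulrAC.
Qed.

End Composition.

Theorem theorem2p4 (disp : measure_display) (T : measurableType disp)
    (R : realType) (P : probability T R) (d : nat)
    (L Rel : T -> set (Zd d * Zd d)) (s t : R)
    (mL : random_relation L) (mRel : random_relation Rel)
    (indep : independent_relations P L Rel)
    (dimL : stochastic_dimension P L s)
    (dimRel : stochastic_dimension P Rel t) :
  random_relation (composition L Rel) /\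
  stochastic_dimension P (composition L Rel) (Num.min (s + t) d%:R).
Proof.
have mLR := measurable_composition mL mRel; split=> //.
have [a [ad -> [CL CL0 bL]]] := dimension_boundsP dimL.
have [b [bd -> [CR CR0 bR]]] := dimension_boundsP dimRel.
have [C1 lower] := composition_lower mL mRel indep ad bd CL0 CR0 bL bR.
set g := Num.max (a + b - d%:R) 0 in lower.
have -> : Num.min (d%:R - a + (d%:R - b)) d%:R = d%:R - g :> R.
  by rewrite /g maxEle minEle; do 2 case: ifP; lra.
have gd : 0 <= g < d%:R.
  rewrite /g le_max lexx orbT /= gt_max.
  by case/andP: ad => a0 ad; case/andP: bd => b0 bd; apply/andP; split; lra.
have [abd|abd] := ltP (d%:R : R) (a + b).
  have gE : g = a + b - d%:R by apply/max_idPl; rewrite subr_ge0 ltW.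
  have [C2 upper] := composition_upper mL mRel indep ad bd abd CL0 CR0 bL bR.
  by apply: dimension_boundsW gd lower _; rewrite gE; exact: upper.
have gE : g = 0 by apply/max_idPr; rewrite subr_le0.
apply: (dimension_boundsW (C2 := 1) gd lower) => x y z w.
apply: (@le_trans _ _ 1%E).
  by apply: probability_le1; apply: measurableI; exact: mLR.
rewrite lee_fin mul1r gE !decay0 mul1r lerDl.
by rewrite ltW // spread_decay_gt0.
Qed.
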